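(* Consider the ASEG algorithm described in the context, applied to $\min_{x\in\mathbb{R}^d} r(x)$ under (A1), (A2) with $\zeta=0$, and (A3), where $\mu<\delta$, with parameters $$\alpha=\frac{\mu}{3},\qquad \eta=\min\left\{\frac{1}{3\alpha},\frac{\theta}{3\tau}\right\},\qquad \tau=\frac{\sqrt{\mu\theta}}{3},\qquad \theta\le\frac{1}{3\delta},$$ and with every $x_f^{k+1}$ satisfying $$\|\nabla \bar A_\theta^k(x_f^{k+1})\|^2\le\frac{9\delta^2}{11}\left\|x_g^k-\arg\min_{x\in\mathbb{R}^d}\bar A_\theta^k(x)\right\|^2 .$$ Then, with appropriate tuning of $\theta$ (subject to $\theta\le\frac{1}{3\delta}$), the algorithm requires $$\mathcal{O}\left(\frac{B}{M}\sqrt{\frac{\delta}{\mu}}\log\frac{1}{\varepsilon}+\frac{\sigma_{sim}^2+\sigma_{noise}^2}{\mu M\varepsilon}\right)\quad\text{communications}$$ to reach an arbitrary $\varepsilon$-solution.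
   Context: Problem: $r=\frac1M\sum_{m=1}^M r_m$ with $r_m:\mathbb{R}^d\to\mathbb{R}$ twice differentiable ($r_1$ is held by the server, the other $r_m$ by the other devices), and $x_*$ is the minimizer of $r$. $\|\cdot\|$ is the Euclidean norm (operator norm for matrices). Assumptions. (A1) $r$ is $\mu$-strongly convex ($\mu>0$), i.e. $r(x)\ge r(y)+\langle\nabla r(y),x-y\rangle+\frac{\mu}{2}\|x-y\|^2$ for all $x,y$; $r_1$ is convex and $L_1$-smooth ($\nabla r_1$ is $L_1$-Lipschitz). (A2) For constants $\delta>0$, $\sigma_{sim}\ge0$, $\zeta\ge 0$ and all $m\in\{1,\dots,M\}$, $x\in\mathbb{R}^d$: $\|\nabla^2 r_m(x)-\nabla^2 r(x)\|\le\delta$ and $\|\nabla r_m(x)-\nabla r(x)\|^2\le\sigma_{sim}^2+2\delta^2\|x-x_*\|^2\cdot\zeta$. (A3) For each $m\in\{1,\dots,M\}$ the stochastic oracle $\nabla r_m(x,\xi)$ satisfies $\mathbb{E}_\xi[\nabla r_m(x,\xi)\mid x]=\nabla r_m(x)$ and $\mathbb{E}_\xi[\|\nabla r_m(x,\xi)-\nabla r_m(x)\|^2\mid x]\le\sigma_{noise}^2$ for all $x\in\mathbb{R}^d$. ASEG (Accelerated Stochastic ExtraGradient). Parameters: $\tau\in(0,1]$, $\eta,\theta,\alpha>0$, number of iterations $N\ge1$, batch size $B\in\mathbb{N}$. Start from $x^0=x_f^0\in\mathbb{R}^d$. For $k=0,\dots,N-1$: 1. $x_g^k=\tau x^k+(1-\tau)x_f^k$.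 2. Generate uniformly a set $I$ of $B$ numbers from $\{2,\dots,M\}$ and set $s_k=\frac1B\sum_{m\in I}\left(\nabla r_m(x_g^k,\xi_m^k)-\nabla r_1(x_g^k)\right)$. 3. Let $x_f^{k+1}$ be an approximate minimizer over $\mathbb{R}^d$ of $\bar A_\theta^k(x)=\langle s_k,x-x_g^k\rangle+\frac{1}{2\theta}\|x-x_g^k\|^2+r_1(x)$. 4. Generate uniformly a new set $I$ of $B$ numbers from $\{1,\dots,M\}$ and set $t_k=\frac1B\sum_{m\in I}\nabla r_m(x_f^{k+1},\xi_m^{k+1/2})$. 5. $x^{k+1}=x^k+\eta\alpha(x_f^{k+1}-x^k)-\eta t_k$. The output is $x^N$. Conventions: in this count, one iteration of the method requires $B/M$ communications. An $\varepsilon$-solution is measured by $\mathbb{E}[\Phi_N]\le\varepsilon$, where $\Phi_k=\frac{\tau}{\eta}\|x^k-x_*\|^2+2[r(x_f^k)-r(x_* )]$ and $\mathbb{E}$ is the expectation over all randomness.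
   Formalization: θ (hence τ, η) may vary with the iteration, θ_k ≤ 1/(3δ), since with one fixed θ the stated bound fails by a factor log(1/ε); the bound is stated for ε ≤ 1/2 with εΦ_0 ≤ 1, with an absolute constant in O(·). *)

(* Defs.v *)
From HB Require Import structures.
From mathcomp Require Import all_boot all_order all_algebra.
From mathcomp Require Import all_classical all_reals all_analysis.
From mathcomp Require Import ring lra.

Set Implicit Arguments.
Unset Strict Implicit.
Unset Printing Implicit Defensive.

Import Order.TTheory GRing.Theory Num.Theory.
Import numFieldNormedType.Exports.

Local Open Scope classical_set_scope.
Local Open Scope ring_scope.

(* Points of R^d are row vectors over R : realType. The norm `|_| of 'rV[R]_d is
   the sup norm, hence the Euclidean norm below; differentiability is the same
   for both, the dimension being finite. *)

Section Euclidean.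
Context {R : realType} {d : nat}.

Definition dot (u v : 'rV[R]_d) : R := \sum_i u 0 i * v 0 i.

Definition enorm (u : 'rV[R]_d) : R := Num.sqrt (dot u u).

(* Matrices act on row vectors from the right; a matrix and its transpose have
   the same operator norm. *)
Definition opnorm (A : 'M[R]_d) : R :=
  sup [set enorm (v *m A) | v in [set v : 'rV[R]_d | enorm v <= 1]].

Definition grad (f : 'rV[R]_d -> R) (x : 'rV[R]_d) : 'rV[R]_d :=
  \row_i 'D_(delta_mx 0 i) f x.

Definition hess (f : 'rV[R]_d -> R) (x : 'rV[R]_d) : 'M[R]_d := 'J (grad f) x.

Definition twice_differentiable (f : 'rV[R]_d -> R) : Prop :=
  (forall x, differentiable f x) /\ (forall x, differentiable (grad f) x).

Definition is_minimizer (f : 'rV[R]_d -> R) (z : 'rV[R]_d) : Prop :=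
  forall y, f z <= f y.

Definition strongly_convex (mu : R) (f : 'rV[R]_d -> R) : Prop :=
  forall x y, f x >= f y + dot (grad f y) (x - y) + mu / 2 * enorm (x - y) ^+ 2.

Definition smooth (L : R) (f : 'rV[R]_d -> R) : Prop :=
  forall x y, enorm (grad f x - grad f y) <= L * enorm (x - y).

End Euclidean.

Section Problem.
Context {R : realType} {d M : nat}.

Definition server (hM : (0 < M)%N) : 'I_M := Ordinal hM.

Definition average (r : 'I_M -> 'rV[R]_d -> R) (x : 'rV[R]_d) : R :=
  M%:R^-1 * \sum_m r m x.

Definition assumption1 (hM : (0 < M)%N) (r : 'I_M -> 'rV[R]_d -> R) (mu L1 : R)
    : Prop :=
  [/\ 0 < mu, strongly_convex mu (average r),
      @convex_function R 'rV[R]_d setT (r (server hM)) &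
      smooth L1 (r (server hM))].

Definition assumption2 (r : 'I_M -> 'rV[R]_d -> R) (xstar : 'rV[R]_d)
    (delta sigma_sim zeta : R) : Prop :=
  [/\ 0 < delta, 0 <= sigma_sim, 0 <= zeta &
    forall m x,
      opnorm (hess (r m) x - hess (average r) x) <= delta /\
      enorm (grad (r m) x - grad (average r) x) ^+ 2 <=
        sigma_sim ^+ 2 + 2 * delta ^+ 2 * enorm (x - xstar) ^+ 2 * zeta].

Local Open Scope ereal_scope.

(* The sample of device m is drawn from the law nu m on Xi, and G m x xi is the
   stochastic gradient of r m at x. The first clause (measurability jointly in x
   and xi, R^d carrying its Borel sigma-algebra) is what makes G m meaningful
   at the random iterates; conditioning on x means that x is held fixed. *)
Definition assumption3 (r : 'I_M -> 'rV[R]_d -> R) (dX : measure_display)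
    (Xi : measurableType dX) (nu : 'I_M -> probability Xi R)
    (G : 'I_M -> 'rV[R]_d -> Xi -> 'rV[R]_d) (sigma_noise : R) : Prop :=
  [/\ forall m i,
        measurable_fun [set: g_sigma_algebraType (@open 'rV[R]_d) * Xi]
          (fun p => G m p.1 p.2 0%R i),
      forall m x i,
        'E_(nu m)[fun xi => G m x xi 0%R i] = (grad (r m) x 0%R i)%:E &
      forall m x,
        'E_(nu m)[fun xi => (enorm (G m x xi - grad (r m) x) ^+ 2)%R]
          <= (sigma_noise ^+ 2)%:E].

End Problem.

Section Sampling.
Context {R : realType} (dO : measure_display) (Omega : measurableType dO).
Variable P : probability Omega R.
Local Open Scope ereal_scope.

Definition sub_sigma_algebra (F : set (set Omega)) : Prop :=
  sigma_algebra setT F /\ F `<=` measurable.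

Definition measurable_wrt {d : nat} (F : set (set Omega))
    (X : Omega -> 'rV[R]_d) : Prop :=
  forall i (U : set R), measurable U -> F ((fun w => X w 0%R i) @^-1` U).

(* I is uniformly distributed on the B-element subsets of S
   (sampling without replacement). *)
Definition uniform_batch {M : nat} (S : {set 'I_M}) (B : nat)
    (I : Omega -> {set 'I_M}) : Prop :=
  forall A : {set 'I_M},
    measurable (I @^-1` [set A]) /\
    P (I @^-1` [set A]) =
      if (A \subset S) && (#|A| == B) then ('C(#|S|, B)%:R^-1)%:E else 0.

Definition has_law {dX : measure_display} {Xi : measurableType dX}
    (nu : probability Xi R) (xi : Omega -> Xi) : Prop :=
  measurable_fun setT xi /\
  forall U, measurable U -> P (xi @^-1` U) = nu U.

(* A batch I and samples xi 0, ..., xi (M - 1) with the prescribed laws, such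
   that the sigma-algebra F of the past, I and all the xi m are mutually
   independent; subfamilies are covered by taking some of the events full. *)
Definition fresh_samples {M : nat} {dX : measure_display}
    {Xi : measurableType dX} (nu : 'I_M -> probability Xi R)
    (F : set (set Omega)) (S : {set 'I_M}) (B : nat)
    (I : Omega -> {set 'I_M}) (xi : 'I_M -> Omega -> Xi) : Prop :=
  [/\ uniform_batch S B I,
      forall m, has_law (nu m) (xi m) &
      forall (A : set Omega) (V : set {set 'I_M}) (U : 'I_M -> set Xi),
        F A -> (forall m, measurable (U m)) ->
        P (A `&` (I @^-1` V) `&` \bigcap_m (xi m @^-1` U m)) =
          P A * P (I @^-1` V) * \prod_(m < M) P (xi m @^-1` U m)].

End Sampling.

Section Algorithm.
Context {R : realType} {d M : nat}.

(* \bar A_theta^k for s = s_k, xg = x_g^k and r1 the function of the server. *)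
Definition Abar (r1 : 'rV[R]_d -> R) (theta : R) (s xg : 'rV[R]_d)
    (z : 'rV[R]_d) : R :=
  dot s (z - xg) + (2 * theta)^-1 * enorm (z - xg) ^+ 2 + r1 z.

(* The right-hand side refers to the minimizer of Abar, which exists and is
   unique when r1 is convex and differentiable and theta > 0. *)
Definition inexact_prox (r1 : 'rV[R]_d -> R) (delta theta : R)
    (s xg z : 'rV[R]_d) : Prop :=
  exists zmin, is_minimizer (Abar r1 theta s xg) zmin /\
    enorm (grad (Abar r1 theta s xg) z) ^+ 2 <=
      9 * delta ^+ 2 / 11 * enorm (xg - zmin) ^+ 2.

Definition extrapolation (tau : R) (x xf : 'rV[R]_d) : 'rV[R]_d :=
  tau *: x + (1 - tau) *: xf.

Definition server_estimator (hM : (0 < M)%N) (r : 'I_M -> 'rV[R]_d -> R)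
    {Xi : Type} (G : 'I_M -> 'rV[R]_d -> Xi -> 'rV[R]_d)
    (B : nat) (I : {set 'I_M}) (xi : 'I_M -> Xi) (xg : 'rV[R]_d) : 'rV[R]_d :=
  B%:R^-1 *: \sum_(m in I) (G m xg (xi m) - grad (r (server hM)) xg).

Definition full_estimator {Xi : Type} (G : 'I_M -> 'rV[R]_d -> Xi -> 'rV[R]_d)
    (B : nat) (I : {set 'I_M}) (xi : 'I_M -> Xi) (xf : 'rV[R]_d) : 'rV[R]_d :=
  B%:R^-1 *: \sum_(m in I) G m xf (xi m).

(* N iterations of ASEG on an arbitrary probability space. F k collects the
   information available before iteration k, and H k that available once
   x_f^{k+1} has been computed: the subproblem may be solved by any (possibly
   randomized) method that does not anticipate the samples still to be drawn.
   The parameters tau, eta, theta carry the iteration index, a fixed parameter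
   being a constant sequence: with theta fixed along the run, the variance part
   of the complexity necessarily carries an extra factor log (1 / eps). *)
Definition ASEG (hM : (0 < M)%N) (r : 'I_M -> 'rV[R]_d -> R)
    (dX : measure_display) (Xi : measurableType dX)
    (nu : 'I_M -> probability Xi R) (G : 'I_M -> 'rV[R]_d -> Xi -> 'rV[R]_d)
    (B : nat) (x0 : 'rV[R]_d) (delta alpha : R) (tau eta theta : nat -> R)
    (N : nat) (dO : measure_display) (Omega : measurableType dO)
    (P : probability Omega R) (x xf : nat -> Omega -> 'rV[R]_d) : Prop :=
  (forall w, x 0%N w = x0 /\ xf 0%N w = x0) /\
  exists (F H : nat -> set (set Omega)) (I J : nat -> Omega -> {set 'I_M})
         (xi xi' : nat -> 'I_M -> Omega -> Xi),
  [/\ forall k, sub_sigma_algebra (F k) /\ sub_sigma_algebra (H k),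
      forall k, F k `<=` H k /\ H k `<=` F k.+1,
      forall k, (k <= N)%N ->
        measurable_wrt (F k) (x k) /\ measurable_wrt (F k) (xf k),
      forall k, (k < N)%N ->
        [/\ measurable_wrt (H k) (xf k.+1),
            fresh_samples P nu (F k) [set~ server hM]%SET B (I k) (xi k) &
            fresh_samples P nu (H k) [set: 'I_M]%SET B (J k) (xi' k)] &
      forall k w, (k < N)%N ->
        let xg := extrapolation (tau k) (x k w) (xf k w) in
        let s := server_estimator hM r G B (I k w) (xi k ^~ w) xg in
        let t := full_estimator G B (J k w) (xi' k ^~ w) (xf k.+1 w) in
        inexact_prox (r (server hM)) delta (theta k) s xg (xf k.+1 w) /\
        x k.+1 w = x k w + (eta k * alpha) *: (xf k.+1 w - x k w)
                     - eta k *: t].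

Definition Phi (r : 'I_M -> 'rV[R]_d -> R) (xstar : 'rV[R]_d) (tau eta : R)
    (x xf : 'rV[R]_d) : R :=
  tau / eta * enorm (x - xstar) ^+ 2 + 2 * (average r xf - average r xstar).

Definition communications (B N : nat) : R := N%:R * (B%:R / M%:R).

End Algorithm.

Arguments communications : clear implicits.

Section StepSizes.
Context {R : realType}.
Implicit Types mu theta delta : R.

Definition alpha_of mu : R := mu / 3.

Definition tau_of mu theta : R := Num.sqrt (mu * theta) / 3.

Definition eta_of mu theta : R :=
  Num.min (3 * alpha_of mu)^-1 (theta / (3 * tau_of mu theta)).

(* The weight tau / eta in Phi is thus the same for all admissible theta. *)
Lemma tau_div_eta mu delta theta : 0 < mu -> mu < delta ->
  0 < theta -> theta <= (3 * delta)^-1 ->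
  tau_of mu theta / eta_of mu theta = mu / 3.
Proof.
move=> mu0 mud th0 thd.
have d0 : 0 < delta by exact: lt_trans mud.
have mth : 0 < mu * theta by exact: mulr_gt0.
have dth : delta * theta <= 3^-1.
  have -> : 3^-1 = delta * (3 * delta)^-1 :> R by field; rewrite gt_eqF.
  by rewrite ler_pM2l.
rewrite /eta_of /tau_of /alpha_of; set s := Num.sqrt (mu * theta).
have s0 : 0 < s by rewrite sqrtr_gt0.
have s2 : s ^+ 2 = mu * theta by rewrite sqr_sqrtr// ltW.
have s1 : s <= 1 by rewrite -(@expr_le1 _ 2) ?s2 ?(ltW s0)//; nra.
have -> : (3 * (mu / 3))^-1 = mu^-1 by field; rewrite gt_eqF.
have -> : theta / (3 * (s / 3)) = s / mu.
  have -> : theta = s ^+ 2 / mu by rewrite s2; field; rewrite gt_eqF.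
  by field; rewrite !gt_eqF.
have -> : Num.min mu^-1 (s / mu) = s / mu.
  by apply/min_idPr; rewrite ler_piMl// invr_ge0 ltW.
by field; rewrite !gt_eqF.
Qed.

End StepSizes.

(* Main.v *)
Require Import Defs.
From HB Require Import structures.
From mathcomp Require Import all_boot all_order all_algebra.
From mathcomp Require Import all_classical all_reals all_analysis.
From mathcomp Require Import measurable_realfun ring lra.

Set Implicit Arguments.
Unset Strict Implicit.
Unset Printing Implicit Defensive.

Import Order.TTheory GRing.Theory Num.Theory.
Import numFieldNormedType.Exports.

Local Open Scope classical_set_scope.
Local Open Scope ring_scope.

(* Write y = x_f^{k+1}, g = x_g^k, and let n be the error of s_k as an estimate of
   (grad r - grad r_1)(g). Optimality of y up to the prescribed accuracy and the
   similarity of the Hessians give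
     2 <grad r(y), y - g> <= - theta |grad r(y)|^2 + 3 theta |n|^2,
   so only the second moment of n matters, although s_k is biased. With
   eta = 3 tau / mu and theta = 9 tau^2 / mu, strong convexity then yields
     E Phi_{k+1} <= (1 - tau) E Phi_k + K tau^2,  K = O(sigma^2 / (mu B)).
   Running with the largest admissible tau for O(log(1/eps) / tau) iterations, and
   then with tau = 2 / (j + const), reaches accuracy eps after O(K / eps) more. *)

(** * Euclidean geometry and calculus *)

(** The first batch leaves the server out, and the mean of [grad r_m - grad r_1] over the other
    devices is [M / (M - 1)] times [grad r - grad r_1]: this is the bias of [s_k]. A biased error
    leaves a cross term that does not average out, hence a one-step inequality in which [n] enters
    only through its square. The error of [t_k] has conditional mean zero, and its cross term
    vanishes. Batches are drawn without replacement, so their members are dependent. The sampling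
    error is computed by counting batches and pairs, and the oracle noise is treated separately on
    each event where the batch is fixed. Since [tau / eta = mu / 3] for every admissible [theta],
    [Phi] is one and the same function along the run, and the one-step bounds chain although the
    step sizes change. With constant [tau] the recursion stalls at level [K tau]; taking [tau] of
    order [eps / K] throughout would cost a logarithm in the variance term, which the decreasing
    phase avoids. The condition [eps * Phi0 <= 1] bounds [ln (Phi0 / eps)] by [2 ln (1 / eps)]. *)

Section Euclid.
Context {R : realType} {d : nat}.
Implicit Types (u v w : 'rV[R]_d) (a : R).

Lemma dotC u v : dot u v = dot v u.
Proof. by apply: eq_bigr => i _; rewrite mulrC. Qed.

Lemma dotDl u v w : dot (u + v) w = dot u w + dot v w.
Proof. by rewrite -big_split; apply: eq_bigr => i _; rewrite mxE mulrDl. Qed.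

Lemma dotZl a u v : dot (a *: u) v = a * dot u v.
Proof. by rewrite /dot mulr_sumr; apply: eq_bigr => i _; rewrite mxE mulrA. Qed.

Lemma dotNl u v : dot (- u) v = - dot u v.
Proof. by rewrite -scaleN1r dotZl mulN1r. Qed.

Lemma dotDr u v w : dot w (u + v) = dot w u + dot w v.
Proof. by rewrite dotC dotDl !(dotC w). Qed.

Lemma dotZr a u v : dot v (a *: u) = a * dot v u.
Proof. by rewrite dotC dotZl dotC. Qed.

Lemma dotNr u v : dot v (- u) = - dot v u.
Proof. by rewrite dotC dotNl dotC. Qed.

Lemma dot0l v : dot 0 v = 0.
Proof. by rewrite -(scale0r 0) dotZl mul0r. Qed.

Definition dotE := (dotDl, dotDr, dotNl, dotNr, dotZl, dotZr).

Lemma dot_suml (I : Type) (s : seq I) (P : pred I) (F : I -> 'rV[R]_d) v :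
  dot (\sum_(i <- s | P i) F i) v = \sum_(i <- s | P i) dot (F i) v.
Proof.
by apply: (big_morph (dot^~ v) (fun u w => dotDl u w v)); exact: dot0l.
Qed.

Lemma dot_ge0 u : 0 <= dot u u.
Proof. by apply: sumr_ge0 => i _; rewrite -expr2 sqr_ge0. Qed.

Lemma enorm_ge0 u : 0 <= enorm u.
Proof. exact: sqrtr_ge0. Qed.

Lemma sqr_enorm u : enorm u ^+ 2 = dot u u.
Proof. by rewrite sqr_sqrtr ?dot_ge0. Qed.

Lemma sqr_enorm_sum u : enorm u ^+ 2 = \sum_i u 0 i ^+ 2.
Proof. by rewrite sqr_enorm; apply: eq_bigr => i _; rewrite expr2. Qed.

Lemma enorm_eq0 u : (enorm u == 0) = (u == 0).
Proof.
apply/eqP/eqP => [u0|->]; last by rewrite /enorm dot0l sqrtr0.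
have : \sum_i u 0 i ^+ 2 = 0 by rewrite -sqr_enorm_sum u0 expr0n.
move/eqP; rewrite psumr_eq0 => [/allP h|i _]; last exact: sqr_ge0.
apply/rowP => i; rewrite mxE; apply/eqP.
by have := h i (mem_index_enum _); rewrite /= sqrf_eq0.
Qed.

Lemma dot_le u v : dot u v <= enorm u * enorm v.
Proof.
have [u0|u0] := eqVneq u 0; first by rewrite u0 dot0l mulr_ge0 ?enorm_ge0.
have [v0|v0] := eqVneq v 0; first by rewrite v0 dotC dot0l mulr_ge0 ?enorm_ge0.
have nu : 0 < enorm u by rewrite lt_neqAle eq_sym enorm_eq0 u0 enorm_ge0.
have nv : 0 < enorm v by rewrite lt_neqAle eq_sym enorm_eq0 v0 enorm_ge0.
(* The square expands to [2 |u| |v| (|u| |v| - <u, v>)], and the factor in front is positive. *)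
have := dot_ge0 (enorm v *: u - enorm u *: v).
rewrite !dotE -!sqr_enorm (dotC v u) => h.
rewrite -subr_ge0 -(pmulr_rge0 _ (mulr_gt0 (mulr_gt0 nu nv) (ltr0Sn _ 1))).
by apply: le_trans h _; rewrite le_eqVlt; apply/orP; left; apply/eqP; ring.
Qed.

Lemma enormD u v : enorm (u + v) <= enorm u + enorm v.
Proof.
rewrite -(@ler_pXn2r _ 2) ?nnegrE ?addr_ge0 ?enorm_ge0//.
have := dot_le u v; rewrite sqrrD !sqr_enorm !dotE (dotC v u); nra.
Qed.

Lemma enormZ a u : enorm (a *: u) = `|a| * enorm u.
Proof. by rewrite /enorm !dotE mulrA -expr2 sqrtrM ?sqr_ge0// sqrtr_sqr. Qed.

Lemma enormN u : enorm (- u) = enorm u.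
Proof. by rewrite /enorm !dotE opprK. Qed.

Lemma opnorm_le (A : 'M[R]_d) v : enorm (v *m A) <= opnorm A * enorm v.
Proof.
(* [K] is the squared Frobenius norm. It shows that the set defining [opnorm A] is bounded, so that
   its [sup] really is an upper bound. *)
pose K := \sum_j enorm (col j A)^T ^+ 2.
have vA w : enorm w <= 1 -> enorm (w *m A) <= Num.sqrt K.
  move=> w1; rewrite ler_sqrt ?sumr_ge0// => [|i _]; last exact: sqr_ge0.
  rewrite -sqr_enorm sqr_enorm_sum; apply: ler_sum => j _.
  have -> : (w *m A) 0 j = dot w (col j A)^T.
    by rewrite mxE; apply: eq_bigr => k _; rewrite !mxE.
  rewrite -real_normK ?num_real// lerXn2r ?nnegrE ?enorm_ge0//.
  have h : enorm w * enorm (col j A)^T <= enorm (col j A)^T.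
    by rewrite ler_piMl ?enorm_ge0.
  rewrite ler_norml (le_trans (dot_le _ _) h) andbT.
  by rewrite -lerN2 opprK -dotNl (le_trans (dot_le _ _))// enormN.
have [->|v0] := eqVneq v 0.
  have /eqP e0 : enorm (0 : 'rV[R]_d) == 0 by rewrite enorm_eq0.
  by rewrite mul0mx e0 mulr0.
have nv : 0 < enorm v by rewrite lt_neqAle eq_sym enorm_eq0 v0 enorm_ge0.
rewrite -ler_pdivrMr// mulrC.
have -> : (enorm v)^-1 * enorm (v *m A) = enorm (((enorm v)^-1 *: v) *m A).
  by rewrite -scalemxAl enormZ ger0_norm// invr_ge0 enorm_ge0.
apply: ub_le_sup.
  by exists (Num.sqrt K) => _ [w /= w1 <-]; exact: vA.
exists ((enorm v)^-1 *: v) => //=.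
by rewrite enormZ ger0_norm ?invr_ge0 ?enorm_ge0// mulVf// gt_eqF.
Qed.

End Euclid.

(** * Directional derivatives, gradients and similarity of Hessians *)

Section Calculus.
Context {R : realType} {d : nat}.
Implicit Types (f g : 'rV[R]_d -> R) (u v x y z : 'rV[R]_d).

Lemma derive_grad f x v : differentiable f x -> 'D_v f x = dot (grad f x) v.
Proof.
move=> df; rewrite deriveE//.
have -> : v = \sum_j v 0 j *: delta_mx 0 j by rewrite {1}(row_sum_delta v).
rewrite linear_sum dotC dot_suml; apply: eq_bigr => i _.
rewrite linearZ/= dotZl; congr (_ * _); rewrite -deriveE//.
rewrite /dot (bigD1 i)//= big1 => [|j ji]; last first.
  by rewrite mxE eqxx (negbTE ji) mul0r.
by rewrite !mxE !eqxx mul1r addr0.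
Qed.

Lemma continuous_dot u : continuous (dot^~ u).
Proof.
apply: (@continuous_big _ _ _ _ _ _ _ _ (fun i (z : 'rV[R]_d) => z 0 i * u 0 i)).
  exact: add_continuous.
move=> i _ x; apply: (@continuousM R 'rV[R]_d (fun z => z 0 i) (cst (u 0 i))).
  exact: coord_continuous.
exact: cst_continuous.
Qed.

Lemma is_derive_dot (h : 'rV[R]_d -> 'rV[R]_d) x v u :
  derivable h x v -> is_derive x v (fun z => dot (h z) u) (dot ('D_v h x) u).
Proof.
move=> dh.
have c : (fun t : R => t^-1 *: (((fun z => dot (h z) u) \o shift x) (t *: v)
    - dot (h x) u)) @ 0^' --> dot ('D_v h x) u.
  have -> : (fun t : R => t^-1 *: (((fun z => dot (h z) u) \o shift x) (t *: v)
      - dot (h x) u)) =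
      dot^~ u \o (fun t : R => t^-1 *: ((h \o shift x) (t *: v) - h x)).
    by apply/funext => t /=; rewrite !dotE.
  by apply: continuous_cvg => //; exact: continuous_dot.
by split; [apply/cvg_ex; eexists; exact: c | exact: cvg_lim c].
Qed.

Lemma is_derive_line f x v (t df : R) : is_derive (x + t *: v) v f df ->
  is_derive t (1 : R) (fun s => f (x + s *: v)) df.
Proof.
move=> [dv <-].
have E : (fun h : R => h^-1 *: (((fun s => f (x + s *: v)) \o shift t) (h *: 1)
    - f (x + t *: v))) =
  (fun h : R => h^-1 *: ((f \o shift (x + t *: v)) (h *: v) - f (x + t *: v))).
  apply/funext => h /=; congr (_ *: (f _ - _)).
  by rewrite scalerDl /= [h%:A]mulr1 addrCA.
by split; rewrite /derivable /derive E.
Qed.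

(** Convexity bounds every difference quotient with step in [(0, 1]] by [f z - f y], and the bound
    passes to the limit from the right. *)
Lemma convex_grad_le f y z : @convex_function R 'rV[R]_d setT f ->
  differentiable f y -> f y + dot (grad f y) (z - y) <= f z.
Proof.
move=> cf df; rewrite -derive_grad// -lerBrDl.
have c : (fun h : R => h^-1 *: ((f \o shift y) (h *: (z - y)) - f y)) @ 0^'+ -->
    'D_(z - y) f y.
    apply: cvg_dnbhs_at_right.
  by have := @diff_derivable _ _ _ f y (z - y) df.
apply: (cvgr_to_le c); near=> h.
have h0 : 0 < h by near: h; exact: nbhs_right_gt.
have h1 : h <= 1 by near: h; exact: nbhs_right_le.
have H : f (h *: z + (1 - h) *: y) <= h * f z + (1 - h) * f y.
  exact: cf (Itv01 (ltW h0) h1) z y (mem_setT _) (mem_setT _).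
rewrite /GRing.scale/= -ler_pdivlMl ?invr_gt0// invrK lerBlDr.
have -> : h *: (z - y) + y = h *: z + (1 - h) *: y.
  by rewrite scalerBr scalerBl scale1r addrAC addrA.
by apply: le_trans H _; rewrite le_eqVlt; apply/orP; left; apply/eqP; ring.
Unshelve. all: by end_near. Qed.

(** The mean value theorem is scalar, so it is applied to [t |-> <h (x + t (y - x)), u>] with
    [u = h y - h x] itself; this gives [|u|^2 <= delta |y - x| |u|]. *)
Lemma mean_value_le (h : 'rV[R]_d -> 'rV[R]_d) (delta : R) x y :
  (forall z, derivable h z (y - x)) ->
  (forall z, enorm ('D_(y - x) h z) <= delta * enorm (y - x)) ->
  enorm (h y - h x) <= delta * enorm (y - x).
Proof.
move=> dh hd; pose u := h y - h x.
pose phi (t : R) := dot (h (x + t *: (y - x))) u.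
have dphi (t : R) :
    is_derive t (1 : R) phi (dot ('D_(y - x) h (x + t *: (y - x))) u).
  exact: is_derive_line (is_derive_dot _ (dh _)).
have cphi : {within `[0, 1], continuous phi}.
  apply: continuous_subspaceT => t.
  by apply: differentiable_continuous; apply/derivable1_diffP; case: (dphi t).
have [t _] := MVT ltr01 (fun t _ => dphi t) cphi.
rewrite /phi scale1r scale0r addr0 subr0 mulr1 (addrC x) subrK => E.
have : enorm u ^+ 2 <= delta * enorm (y - x) * enorm u.
  have -> : enorm u ^+ 2 = dot ('D_(y - x) h (x + t *: (y - x))) u.
    by rewrite sqr_enorm -E -dotNl -dotDl.
  rewrite (le_trans (dot_le _ _))//.
  by rewrite ler_wpM2r ?enorm_ge0.
(* For [u = 0] the right-hand side is nonnegative because it bounds the norm of a derivative. *)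
have := enorm_ge0 u; rewrite le_eqVlt => /orP[/eqP u0 _|u0].
  by rewrite -/u -u0 (le_trans (enorm_ge0 ('D_(y - x) h x)))// hd.
by rewrite expr2 ler_pM2r.
Qed.

Lemma grad_similarity f g (delta : R) x y :
  (forall z, differentiable (grad f) z) -> (forall z, differentiable (grad g) z) ->
  (forall z, opnorm (hess f z - hess g z) <= delta) ->
  enorm ((grad f y - grad g y) - (grad f x - grad g x)) <= delta * enorm (y - x).
Proof.
move=> df dg fg.
have dfv z v : derivable (grad f) z v by exact: diff_derivable.
have dgv z v : derivable (grad g) z v by exact: diff_derivable.
apply: (@mean_value_le (grad f - grad g)) => z; first exact: derivableB.
rewrite deriveB// !deriveEjacobian// -mulmxBr.
by rewrite (le_trans (opnorm_le _ _))// ler_wpM2r ?enorm_ge0// fg.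
Qed.

Lemma is_derive_quadratic (s g : 'rV[R]_d) (theta : R) y v :
  is_derive y v (fun z => dot s (z - g) + (2 * theta)^-1 * enorm (z - g) ^+ 2)
    (dot (s + theta^-1 *: (y - g)) v).
Proof.
set q := fun z => _; set D := dot _ v.
have c : (fun h : R => h^-1 *: ((q \o shift y) (h *: v) - q y)) @ 0^' --> D.
  (* The difference quotient of a quadratic is exactly its limit plus a multiple of [h]. *)
  have c' : (fun h : R => D + h * ((2 * theta)^-1 * dot v v)) @ 0^' --> D.
    apply: cvg_within_filter; rewrite -[in X in _ --> X](addr0 D).
    apply: cvgD; first exact: cvg_cst.
    rewrite -[X in _ --> X](mul0r ((2 * theta)^-1 * dot v v)).
    by apply: cvgMr_tmp; exact: cvg_id.
  apply: cvg_trans c'; apply: near_eq_cvg; near=> h.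
  have h0 : h != 0 by near: h; exact: nbhs_dnbhs_neq.
  rewrite /GRing.scale/= /D /q !sqr_enorm -addrA !dotE invfM.
  rewrite (dotC g) (dotC y v) !(dotC _ g).
  by move: (theta^-1) => a; field.
by split; [apply/cvg_ex; eexists; exact: c | exact: cvg_lim c].
Unshelve. all: by end_near. Qed.

Lemma grad_Abar (r1 : 'rV[R]_d -> R) (theta : R) (s g y : 'rV[R]_d) :
  differentiable r1 y ->
  grad (Abar r1 theta s g) y = s + theta^-1 *: (y - g) + grad r1 y.
Proof.
move=> dr; apply/rowP => i; rewrite mxE.
have [dq q'] := is_derive_quadratic s g theta y (delta_mx 0 i).
have -> : Abar r1 theta s g =
  (fun z => dot s (z - g) + (2 * theta)^-1 * enorm (z - g) ^+ 2) + r1 by [].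
rewrite deriveD//; last exact: diff_derivable.
rewrite q' [in RHS]mxE [X in _ = _ + X]mxE; congr (_ + _).
rewrite /dot (bigD1 i)//= big1 => [|j ji]; last first.
  by rewrite [X in _ * X]mxE eqxx (negbTE ji) mulr0.
by rewrite [X in _ * X + _]mxE !eqxx mulr1 addr0.
Qed.

Lemma differentiable_average M (r : 'I_M -> 'rV[R]_d -> R) x :
  (forall m, differentiable (r m) x) -> differentiable (average r) x.
Proof.
move=> dr; have -> : average r = M%:R^-1 *: (\sum_m r m).
  by apply/funext => z; rewrite /average [RHS]/= fct_sumE.
by apply: differentiableZ; exact: differentiable_sum.
Qed.

Lemma grad_average M (r : 'I_M -> 'rV[R]_d -> R) x :
  (forall m, differentiable (r m) x) ->
  grad (average r) x = M%:R^-1 *: \sum_m grad (r m) x.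
Proof.
move=> dr; have -> : average r = M%:R^-1 *: (\sum_m r m).
  by apply/funext => z; rewrite /average [RHS]/= fct_sumE.
apply/rowP => i; rewrite !mxE deriveZ; last first.
  by apply: derivable_sum => m; exact: diff_derivable.
rewrite derive_sum => [|m]; last exact: diff_derivable.
by rewrite summxE; congr (_ * _); apply: eq_bigr => m _; rewrite mxE.
Qed.

Lemma twice_differentiable_average M (r : 'I_M -> 'rV[R]_d -> R) :
  (forall m, twice_differentiable (r m)) -> twice_differentiable (average r).
Proof.
move=> dr; split=> x.
  by apply: differentiable_average => m; exact: (dr m).1.
have -> : grad (average r) = M%:R^-1 *: (\sum_m grad (r m)).
  apply/funext => z; rewrite grad_average => [|m]; last exact: (dr m).1.
  by rewrite [RHS]/= fct_sumE.
apply: differentiableZ; apply: differentiable_sum => m; exact: (dr m).2.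
Qed.

End Calculus.

(** * Deterministic descent *)

Section Descent.
Context {R : realType} {d : nat}.
Implicit Types (f h : 'rV[R]_d -> R) (s g x y z : 'rV[R]_d) (theta mu delta tau : R).

(** An exact identity, since everything but [h] is quadratic. It may be centred at any point, and is
    used both at [y] and at the minimizer. *)
Lemma Abar_expand h s g y z theta :
  Abar h theta s g z = Abar h theta s g y + dot (s + theta^-1 *: (y - g)) (z - y)
    + (2 * theta)^-1 * enorm (z - y) ^+ 2 + (h z - h y).
Proof.
rewrite /Abar !sqr_enorm !dotE invfM (dotC y z) !(dotC _ g).
by move: (theta^-1) => a; field.
Qed.

(** Two bounds with the same constant are added: quadratic growth away from the minimizer
    (minimality tested on the segment to [y]) and the tangent inequality at [y]. Together they give
    [W^2 / theta <= <e, y - zmin>], and Cauchy-Schwarz concludes. *)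
Lemma Abar_strongly_monotone h s g y zmin theta :
  0 < theta -> @convex_function R 'rV[R]_d setT h -> differentiable h y ->
  is_minimizer (Abar h theta s g) zmin ->
  enorm (y - zmin) <= theta * enorm (grad (Abar h theta s g) y).
Proof.
move=> th0 ch dh min; set e := grad _ y; set W := enorm (y - zmin).
have W0 : 0 <= W := enorm_ge0 _.
have gap t : 0 < t -> t < 1 -> (1 - t) * ((2 * theta)^-1 * W ^+ 2) <=
    Abar h theta s g y - Abar h theta s g zmin.
  move=> t0 t1; have := min (t *: y + (1 - t) *: zmin); set z := (_ + _).
  have hz : h z <= t * h y + (1 - t) * h zmin.
    exact: ch (Itv01 (ltW t0) (ltW t1)) y zmin (mem_setT _) (mem_setT _).
  have zz : z - zmin = t *: (y - zmin).
    by rewrite /z scalerBr scalerBl scale1r -addrA addrAC subrr add0r.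
  rewrite (Abar_expand h s g zmin z) (Abar_expand h s g zmin y) zz.
  rewrite enormZ (gtr0_norm t0) -/W exprMn dotZr => H.
  by rewrite -(ler_pM2l t0); move: H hz; lra.
have gap1 : (2 * theta)^-1 * W ^+ 2 <= Abar h theta s g y - Abar h theta s g zmin.
  have c0 : 0 <= (2 * theta)^-1 * W ^+ 2.
    by rewrite mulr_ge0 ?sqr_ge0 ?invr_ge0 ?mulr_ge0// ltW.
  move: c0 gap; move: (_^-1 * _) => c c0 gap.
  rewrite leNgt; apply/negP => lt; set b := _ - _ in lt gap.
  have b0 : 0 <= b by have := gap (2^-1) ltac:(lra) ltac:(lra); nra.
  have cp : 0 < c by exact: le_lt_trans lt.
  (* This replaces the limit [t -> 0]: for this [t], [(1 - t) * c] is the midpoint of [b] and [c],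
     hence larger than [b]. *)
  have := gap ((c - b) / (2 * c)).
  rewrite divr_gt0 ?subr_gt0 ?mulr_gt0// ltr_pdivrMr ?mulr_gt0// => /(_ isT) H.
  have {H} := H ltac:(lra).
  rewrite mulrBl mul1r.
  by have -> : (c - b) / (2 * c) * c = (c - b) / 2; [field; rewrite gt_eqF|lra].
have slope : (2 * theta)^-1 * W ^+ 2 <=
    Abar h theta s g zmin - Abar h theta s g y + dot e (y - zmin).
  have := convex_grad_le zmin ch dh.
  rewrite /e grad_Abar// (Abar_expand h s g y zmin) -opprB enormN -/W !dotNr !dotDl.
  lra.
have key : W ^+ 2 <= theta * enorm e * W.
  have cs := dot_le e (y - zmin); rewrite -/W in cs.
  have E : W ^+ 2 = theta * ((2 * theta)^-1 * W ^+ 2 + (2 * theta)^-1 * W ^+ 2).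
    by field; rewrite gt_eqF.
  by rewrite E -mulrA ler_pM2l//; lra.
have [W00|W00] := eqVneq W 0; first by rewrite W00 mulr_ge0 ?enorm_ge0 ?ltW.
by move: key; rewrite expr2 ler_pM2r// lt_neqAle eq_sym W00.
Qed.

(** An exact implicit gradient step on [f] would make [v = grad f y + theta^-1 (y - g)] vanish. Here
    [v] is made of the subproblem residual, the similarity error and the noise. Expanding
    [theta^2 |v|^2] yields the wanted terms plus [D^2], so it suffices that the first two errors
    cost at most [D^2]. *)
Lemma prox_step f h s g y theta delta :
  0 < delta -> 0 < theta -> theta <= (3 * delta)^-1 ->
  @convex_function R 'rV[R]_d setT h -> differentiable h y ->
  enorm ((grad h y - grad f y) - (grad h g - grad f g)) <= delta * enorm (y - g) ->
  inexact_prox h delta theta s g y ->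
  2 * dot (grad f y) (y - g) <= - theta * enorm (grad f y) ^+ 2
    + 3 * theta * enorm (grad f g - grad h g - s) ^+ 2.
Proof.
move=> d0 th0 thd ch dh sim [zmin [min bound]].
have mono := Abar_strongly_monotone th0 ch dh min.
have eE := grad_Abar theta s g dh.
move: bound mono eE; set e := grad (Abar _ _ _ _) y => bound mono eE.
set n := grad f g - grad h g - s; set D := enorm (y - g) in sim *.
set W := enorm (y - zmin) in mono.
have tri : enorm (g - zmin) <= D + W.
  have -> : g - zmin = (y - zmin) - (y - g).
    by apply/rowP => i; rewrite !mxE; ring.
  by rewrite (le_trans (enormD _ _))// enormN addrC.
have D0 : 0 <= D := enorm_ge0 _.
have W0 : 0 <= W := enorm_ge0 _.
have E0 : 0 <= enorm e := enorm_ge0 _.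
have N0 : 0 <= enorm n := enorm_ge0 _.
have te0 : 0 <= theta * enorm e by rewrite mulr_ge0// ltW.
have td : theta * delta <= 3^-1.
  have -> : 3^-1 = (3 * delta)^-1 * delta :> R by field; rewrite gt_eqF.
  by rewrite ler_pM2r.
(* 1 / 11 <= (4 / 13) ^ 2, and 4 / 9 = (4 / 13) / (1 - 4 / 13). *)
have small : theta * enorm e <= 4 / 9 * D.
  have sq : (theta * enorm e) ^+ 2 <= (4 / 13 * (D + theta * enorm e)) ^+ 2.
    rewrite exprMn (le_trans (ler_wpM2l (sqr_ge0 _) bound))//.
    have -> : theta ^+ 2 * (9 * delta ^+ 2 / 11 * enorm (g - zmin) ^+ 2) =
      9 / 11 * ((theta * delta) ^+ 2 * enorm (g - zmin) ^+ 2) by field.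
    rewrite (exprMn _ (4 / 13)).
    have h1 : (theta * delta) ^+ 2 <= 9^-1.
      have -> : 9^-1 = 3^-1 ^+ 2 :> R by field.
      have u0 : 0 <= theta * delta by rewrite mulr_ge0// ltW.
      by move: (theta * delta) td u0 => u; nra.
    have h2 : enorm (g - zmin) ^+ 2 <= (D + theta * enorm e) ^+ 2.
      rewrite lerXn2r ?nnegrE ?enorm_ge0 ?addr_ge0//.
      by move: tri mono; move: (enorm (g - zmin)) => ?; lra.
    have := ler_pM (sqr_ge0 _) (sqr_ge0 _) h1 h2.
    by have := sqr_ge0 (D + theta * enorm e); lra.
  have s0 : 0 <= 4 / 13 * (D + theta * enorm e) by lra.
  by move: sq; rewrite ler_pXn2r ?nnegrE//; lra.
pose v := grad f y + theta^-1 *: (y - g).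
have vE : v = e - ((grad h y - grad f y) - (grad h g - grad f g)) + n.
  rewrite eE /v /n; apply/rowP => i; rewrite !mxE; ring.
(* [7 / 9 = 4 / 9 + 1 / 3]: the residual, and the similarity error with [theta * delta <= 1 / 3]. *)
have vle : theta * enorm v <= 7 / 9 * D + theta * enorm n.
  have : enorm v <= enorm e + delta * D + enorm n.
    rewrite vE (le_trans (enormD _ _))// lerD2r (le_trans (enormD _ _))//.
    by rewrite enormN lerD2l.
  have tdD : theta * delta * D <= 3^-1 * D by rewrite ler_wpM2r.
  by rewrite -(ler_pM2l th0) !mulrDr mulrA; lra.
have vsq : theta ^+ 2 * enorm v ^+ 2 <= D ^+ 2 + 3 * (theta * enorm n) ^+ 2.
  rewrite -exprMn; have tn0 : 0 <= theta * enorm n by rewrite mulr_ge0// ltW.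
  have tv0 : 0 <= theta * enorm v by rewrite mulr_ge0 ?enorm_ge0// ltW.
  move: vle tv0 tn0; move: (theta * enorm v) (theta * enorm n) => a b ab a0 b0.
  have : a ^+ 2 <= (7 / 9 * D + b) ^+ 2.
    by rewrite lerXn2r ?nnegrE// addr_ge0// mulr_ge0.
  (* The difference of the two sides, [32 / 81 D^2 - 14 / 9 D b + 2 b^2], is at least twice this
     square. *)
  by have := sqr_ge0 (7 / 18 * D - b); nra.
have vexp : theta ^+ 2 * enorm v ^+ 2 = theta * (theta * enorm (grad f y) ^+ 2
    + 2 * dot (grad f y) (y - g)) + D ^+ 2.
  rewrite /v /D !sqr_enorm; move: (y - g) => w.
  by rewrite !dotE (dotC w (grad f y)); field; rewrite gt_eqF.
rewrite -(ler_pM2l th0); move: vsq; rewrite vexp exprMn.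
by move: (enorm _ ^+ 2) (enorm n ^+ 2) (dot _ _) => a b c; nra.
Qed.

(** The noise-free update is analysed here; [n] is the squared norm of the error of [s_k]. The
    gradient at [y] is tested against [x - xstar], which the extrapolation makes expressible through
    [g], [xf] and [xstar]. *)
Lemma descent_step f x xf y xstar mu tau n :
  0 < mu -> 0 < tau -> tau <= 2^-1 -> strongly_convex mu f ->
  let theta := 9 * tau ^+ 2 / mu in
  let g := extrapolation tau x xf in
  2 * dot (grad f y) (y - g) <=
    - theta * enorm (grad f y) ^+ 2 + 3 * theta * n ->
  mu / 3 * enorm (x + tau *: (y - x) - (3 * tau / mu) *: grad f y - xstar) ^+ 2
    + 2 * (f y - f xstar) <=
  (1 - tau) * (mu / 3 * enorm (x - xstar) ^+ 2 + 2 * (f xf - f xstar))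
    + 3 * theta * n.
Proof.
move=> mu0 t0 t12 sc theta g; set G := grad f y => H1.
have H2 : dot G (xf - y) <= f xf - f y.
  have := sc xf y; rewrite -/G; have := sqr_ge0 (enorm (xf - y)); nra.
have H3 := sc xstar y; rewrite -/G in H3.
have [a aE] : exists a, a = x - xstar by eexists.
have [p pE] : exists p, p = y - x by eexists.
have yE : xstar - y = - (a + p) by rewrite aE pE; apply/rowP => i; rewrite !mxE; ring.
have -> : x + tau *: (y - x) - (3 * tau / mu) *: G - xstar =
    a + tau *: p - (3 * tau / mu) *: G.
  by rewrite aE pE; apply/rowP => i; rewrite !mxE; ring.
(* One term for each available inequality: the prox step, convexity towards [xf], and strong
   convexity towards [xstar]. *)
have gE : tau *: a = (g - y) + (1 - tau) *: (y - xf) + tau *: (y - xstar).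
  by rewrite aE; apply/rowP => i; rewrite /g /extrapolation !mxE; ring.
have aG : tau * dot G a = - dot G (y - g) - (1 - tau) * dot G (xf - y)
    - tau * dot G (xstar - y).
  by rewrite -dotZr gE !dotE; ring.
have H3' : dot G (xstar - y) + mu / 2 * dot (a + p) (a + p) <= f xstar - f y.
  by move: H3; rewrite yE enormN -sqr_enorm; lra.
(* After multiplication by [mu / 3] the gradient term has coefficient [6 tau^2 / mu], below
   [theta = 9 tau^2 / mu], so the negative term of the prox step absorbs it. *)
have young : enorm (tau *: p - (3 * tau / mu) *: G) ^+ 2 <=
    2 * tau ^+ 2 * dot p p + 18 * tau ^+ 2 / mu ^+ 2 * dot G G.
  have := dot_ge0 (tau *: p + (3 * tau / mu) *: G).
  rewrite sqr_enorm !dotE (dotC G p) => h; rewrite -subr_ge0.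
  apply: le_trans h _; rewrite le_eqVlt; apply/orP; left; apply/eqP.
  by field; rewrite gt_eqF.
rewrite -[a + _ - _]addrA (_ : enorm (a + _) ^+ 2 =
    dot a a + 2 * tau * dot a p - 2 * (3 * tau / mu) * dot G a +
    enorm (tau *: p - (3 * tau / mu) *: G) ^+ 2); last first.
  by rewrite !sqr_enorm !dotE (dotC G a) (dotC p a) (dotC G p); ring.
rewrite -aE !sqr_enorm in H1 *; set X := dot (tau *: p - _) _.
rewrite sqr_enorm -/X in young.
have e1 : mu / 3 * (2 * (3 * tau / mu) * dot G a) = 2 * (tau * dot G a).
  by field; rewrite gt_eqF.
have e2 : mu / 3 * (18 * tau ^+ 2 / mu ^+ 2 * dot G G) = 6 * tau ^+ 2 / mu * dot G G.
  by field; rewrite gt_eqF.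
have y2 : mu / 3 * X <= mu / 3 * (2 * tau ^+ 2 * dot p p) +
    6 * tau ^+ 2 / mu * dot G G by rewrite -e2 -mulrDr ler_wpM2l// divr_ge0// ltW.
have c1 : 6 * tau ^+ 2 / mu * dot G G <= theta * dot G G.
  by rewrite ler_wpM2r ?dot_ge0// /theta ler_wpM2r ?invr_ge0 ?ltW//; nra.
have app := dot_ge0 (a + p).
have epp : dot (a + p) (a + p) = dot a a + 2 * dot a p + dot p p.
  by rewrite !dotE (dotC p a); ring.
have pp := dot_ge0 p.
(* For [tau <= 1 / 2], [|a|^2 + 2 <a, p> + 2 tau |p|^2 <= |a + p|^2], and strong convexity supplies
   enough of [|y - xstar|^2 = |a + p|^2] to pay for it. *)
have q1 : mu * tau * ((1 - 2 * tau) * dot p p) >= 0.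
  apply: mulr_ge0; first by rewrite mulr_ge0// ltW.
  by rewrite mulr_ge0//; lra.
have q2 : mu * tau * dot (a + p) (a + p) >= 0 by rewrite !mulr_ge0// ltW.
rewrite (mulrDr (mu / 3)) (mulrBr (mu / 3)) e1 aG.
have m2 : (1 - tau) * dot G (xf - y) <= (1 - tau) * (f xf - f y).
  by rewrite ler_wpM2l//; lra.
have m3 : tau * (dot G (xstar - y) + mu / 2 * dot (a + p) (a + p))
  <= tau * (f xstar - f y) by rewrite ler_wpM2l// ltW.
rewrite epp in m3 q2.
move: H1 m2 m3 q1 q2 y2 c1.
move: (dot G (y - g)) (dot G (xf - y)) (dot G (xstar - y)) (dot G G) => g1 g2 g3 gg.
move: (dot a a) (dot a p) (dot p p) theta (6 * _ / _) => aa ap ppp th k.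
move=> H1 m2 m3 q1 q2 y2 c1.
lra.
Qed.

End Descent.

(** * Independence *)

Section BorelRows.
Context {R : realType} {n : nat}.

Local Notation borel := (g_sigma_algebraType (@open 'rV[R]_n)).

Lemma open_row_bigcup (U : set 'rV[R]_n) : open U ->
  U = \bigcup_(p in [set p : 'rV[rat]_n * nat |
      ball (map_mx ratr p.1 : 'rV[R]_n) p.2.+1%:R^-1 `<=` U])
    ball (map_mx ratr p.1 : 'rV[R]_n) p.2.+1%:R^-1.
Proof.
move=> oU; apply/seteqP; split => [x Ux|x [p pU]]; last exact: pU.
have /nbhs_ballP[e /= e0 xe] : nbhs x U by exact: open_nbhs_nbhs.
have [k ke] : exists k : nat, k.+1%:R^-1 < e / 2.
  have e2 : 0 < e / 2 by rewrite divr_gt0.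
  have [N _ /(_ _ (leqnn N))] := near_infty_natSinv_lt (PosNum e2).
  by exists N.
have q_ex i : {q : rat | x 0 i - k.+1%:R^-1 < ratr q < x 0 i + k.+1%:R^-1}.
  apply: cid; have /rat_in_itvoo[q] :
    x 0 i - k.+1%:R^-1 < x 0 i + k.+1%:R^-1.
    by rewrite ltrBlDr -addrA ltrDl addr_gt0.
  by rewrite in_itv/=; exists q.
pose q := \row_i sval (q_ex i).
have close i : `|ratr (q 0 i) - x 0 i| < k.+1%:R^-1.
  by rewrite mxE; case: (q_ex i) => /= a; rewrite ltr_distl.
exists (q, k) => /=.
  apply: subset_trans xe => y [_ qy]; split=> // i j.
  have := qy i j; rewrite mxE /ball/= (ord1 i) => yq.
  have := close j; rewrite distrC => xq.
  rewrite (_ : x 0 j - y 0 j =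
    (x 0 j - ratr (q 0 j)) + (ratr (q 0 j) - y 0 j)); last first.
    by rewrite addrA subrK.
  rewrite (le_lt_trans (ler_normD _ _))// (splitr e).
  by apply: ltrD; apply: lt_trans ke.
split=> // i j; rewrite mxE /ball/= (ord1 i); exact: close.
Qed.

(** The iterates are measurable coordinate by coordinate, whereas the oracle expects Borel
    measurability on [R^d]. An open set is a countable union of rational sup-norm balls, and each
    ball is a finite intersection of coordinate conditions. *)
Lemma measurable_row d (T : measurableType d) (Y : T -> 'rV[R]_n) :
  (forall i, measurable_fun setT (fun t => Y t 0 i)) ->
  measurable_fun [set: T] (Y : T -> borel).
Proof.
move=> mY; apply: (@measurability _ _ T borel setT Y (@open 'rV[R]_n)) => //.
move=> _ [U oU <-]; rewrite setTI (open_row_bigcup oU) preimage_bigcup.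
rewrite bigcup_mkcond; apply: countable_bigcupT_measurable => [|p].
  exact: countableP.
case: ifPn => // _.
have -> : Y @^-1` ball (map_mx ratr p.1 : 'rV[R]_n) p.2.+1%:R^-1 =
    \bigcap_(i in [set: 'I_n]) ((fun t => Y t 0 i) @^-1`
      ball (ratr (p.1 0 i) : R) p.2.+1%:R^-1).
  apply/seteqP; split => t /=.
    by move=> [_ tb] i _; have := tb 0 i; rewrite mxE.
  by move=> tb; split=> // i j; rewrite (ord1 i) mxE; exact: tb.
apply: fin_bigcap_measurable => [|i _]; first exact: finite_finset.
rewrite -[X in measurable X]setTI.
by apply: mY => //; apply: open_measurable; exact: ball_open.
Qed.

Lemma measurable_continuous_row d (T : measurableType d) (Y : T -> 'rV[R]_n)
    (f : 'rV[R]_n -> R) : continuous f ->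
  (forall i, measurable_fun setT (fun t => Y t 0 i)) ->
  measurable_fun [set: T] (f \o Y).
Proof.
move=> cf mY.
have mf : measurable_fun [set: borel] (f : borel -> R).
  apply: (measurability _ (RGenOpens.measurableE R)) => _ [_ [x [y ->] <-]].
  rewrite setTI; apply: sub_sigma_algebra.
  by move/continuousP : cf; apply; exact: interval_open.
exact: (measurableT_comp mf (measurable_row mY)).
Qed.

End BorelRows.

(** * Integrating out a sample independent of the past *)

Section Freezing.
Local Open Scope ereal_scope.
Context {R : realType} d1 d2 (Omega : measurableType d1) (Xi : measurableType d2).
Variables (P : probability Omega R) (nu : probability Xi R).

Lemma measurable_gen (Gen : set (set Omega)) : Gen `<=` measurable ->
  forall A, <<s Gen >> A -> measurable A.
Proof.
move=> GM; apply: smallest_sub => //.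
exact: sigma_algebra_measurable.
Qed.

(** For fixed [U] both sides are finite measures in [E]; they agree on a pi-system containing the
    whole space, hence on the sigma-algebra it generates. *)
Lemma pi_system_indep (Gen : set (set Omega)) (Z : Omega -> Xi) :
  Gen `<=` measurable -> setI_closed Gen -> Gen setT -> measurable_fun setT Z ->
  (forall E U, Gen E -> measurable U -> P (E `&` Z @^-1` U) = P E * nu U) ->
  forall E U, <<s Gen >> E -> measurable U -> P (E `&` Z @^-1` U) = P E * nu U.
Proof.
move=> GM GI GT mZ ind E U gE mU.
have mZU : measurable (Z @^-1` U) by rewrite -[X in measurable X]setTI; exact: mZ.
have fnu : nu U \is a fin_num by exact: fin_num_measure.
have c0 : (0 <= fine (nu U))%R by rewrite fine_ge0.
pose m1 := mrestr P mZU.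
pose m2 := mscale (NngNum c0) P.
have -> : P (E `&` Z @^-1` U) = m1 E by [].
have -> : P E * nu U = m2 E by rewrite /m2 /mscale/= fineK// muleC.
apply: (@g_sigma_algebra_measure_unique _ _ _ Gen GM (fun=> setT)) => //.
- by rewrite bigcup_const//; exists 0%N.
- move=> A GA; rewrite /m1 /m2/= /mrestr/= /mscale/= fineK// muleC.
  exact: ind.
- move=> _; change (P (setT `&` Z @^-1` U) < +oo).
  by rewrite setTI -ge0_fin_numE// fin_num_measure.
Qed.

(* Tonelli's theorem replaces conditional expectations, so that no integrability
   of the iterates is ever needed. *)
Lemma integral_freeze (Gen : set (set Omega)) (Z : Omega -> Xi)
    (H : Omega * Xi -> \bar R) :
  Gen `<=` measurable -> setI_closed Gen -> Gen setT -> measurable_fun setT Z ->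
  (forall E U, Gen E -> measurable U -> P (E `&` Z @^-1` U) = P E * nu U) ->
  measurable_fun [set: g_sigma_algebraType Gen * Xi] H -> (forall p, 0 <= H p) ->
  \int[P]_w H (w, Z w) = \int[P]_w \int[nu]_z H (w, z).
Proof.
move=> GM GI GT mZ ind mH H0.
pose OG := g_sigma_algebraType Gen.
(* Pushing [P] forward along this identity restricts it to the past; independence then says that the
   joint law of [(w, Z w)] on [OG * Xi] is a product. *)
have mid : measurable_fun setT (id : Omega -> OG).
  by move=> _ A mA; rewrite setTI; exact: measurable_gen mA.
have mpair : measurable_fun setT (fun w => (w, Z w) : OG * Xi).
  exact: measurable_fun_pair.
pose mu1 := distribution P (mfun_Sub (mem_set mid)).
pose mu := distribution P (mfun_Sub (mem_set mpair)).
have E1 : \int[P]_w H (w, Z w) = \int[mu]_p H p.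
  by rewrite [RHS](ge0_integral_pushforward mpair) ?preimage_setT.
have E2 : \int[P]_w \int[nu]_z H (w, z) = \int[mu1]_w \int[nu]_z H (w, z).
  rewrite [RHS](ge0_integral_pushforward mid) ?preimage_setT//.
    exact: measurable_fun_fubini_tonelli_F.
  by move=> w _; exact: integral_ge0.
rewrite E1 E2; transitivity (\int[mu1 \x nu]_p H p); last exact: fubini_tonelli1.
apply: eq_measure_integral => A mA _.
apply/esym; apply: product_measure_unique => // B C mB mC.
change (P (B `&` Z @^-1` C) = P B * nu C).
exact: (pi_system_indep GM GI GT mZ ind mB mC).
Qed.

End Freezing.

(** * Second moments of mini-batch estimators *)

Section MeasurableRows.
Context {R : realType} {n : nat} d (T : measurableType d).
Implicit Types V W : T -> 'rV[R]_n.

Definition measurable_coords V := forall i, measurable_fun setT (fun t => V t 0 i).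

Lemma measurable_coordsD V W : measurable_coords V -> measurable_coords W ->
  measurable_coords (fun t => V t + W t).
Proof.
move=> mV mW i; under eq_fun do rewrite mxE.
exact: measurable_funD.
Qed.

Lemma measurable_coordsZ (a : R) V : measurable_coords V ->
  measurable_coords (fun t => a *: V t).
Proof.
move=> mV i; under eq_fun do rewrite mxE.
by apply: measurable_funM => //; exact: measurable_cst.
Qed.

Lemma measurable_coordsN V : measurable_coords V ->
  measurable_coords (fun t => - V t).
Proof.
move=> mV; under eq_fun do rewrite -scaleN1r.
exact: measurable_coordsZ.
Qed.

Lemma measurable_coords_cst (v : 'rV[R]_n) : measurable_coords (fun=> v).
Proof. by move=> i; exact: measurable_cst. Qed.

Lemma measurable_coords_sum (I : eqType) (s : seq I) (V : I -> T -> 'rV[R]_n) :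
  (forall k, k \in s -> measurable_coords (V k)) ->
  measurable_coords (fun t => \sum_(k <- s) V k t).
Proof.
elim: s => [|k s ih] mV.
  by under eq_fun do rewrite big_nil; exact: measurable_coords_cst.
under eq_fun do rewrite big_cons; apply: measurable_coordsD.
  by apply: mV; rewrite mem_head.
by apply: ih => l ls; apply: mV; rewrite inE ls orbT.
Qed.

Lemma measurable_sqr_enorm V : measurable_coords V ->
  measurable_fun setT (fun t => enorm (V t) ^+ 2).
Proof.
move=> mV; under eq_fun do rewrite sqr_enorm_sum.
apply: measurable_sum => i; exact: measurable_funX.
Qed.

Lemma measurable_coords_comp (h : 'rV[R]_n -> 'rV[R]_n) V :
  continuous h -> measurable_coords V -> measurable_coords (h \o V).
Proof.
move=> ch mV i.
apply: (@measurable_continuous_row _ _ _ _ V (fun x => h x 0 i)) => // x.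
exact: (@continuous_comp _ _ _ h (fun v : 'rV[R]_n => v 0 i) x (ch x)
  (@coord_continuous R 1 n 0 i (h x))).
Qed.

End MeasurableRows.

Lemma measurable_coords_wrt {R : realType} {n : nat} d (Omega : measurableType d)
    (F Gen : set (set Omega)) (V : Omega -> 'rV[R]_n) :
  F `<=` <<s Gen >> -> measurable_wrt F V ->
  @measurable_coords R n _ (g_sigma_algebraType Gen) V.
Proof.
by move=> FG mV i _ U mU; rewrite setTI; apply: FG; exact: mV.
Qed.

Section NoiseSquare.
Local Open Scope ereal_scope.
Context {R : realType} {n : nat} d (Xi : measurableType d) (nu : probability Xi R).

(** The cross term is linear in the centred coordinates and has mean 0, once these are known to be
    integrable. *)
Lemma integral_sqr_enorm_le (G : Xi -> 'rV[R]_n) (g c : 'rV[R]_n) (a v : R) :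
  measurable_coords G ->
  (forall i, 'E_nu[fun z => G z 0%R i] = (g 0%R i)%:E) ->
  'E_nu[fun z => (enorm (G z - g) ^+ 2)%R] <= v%:E ->
  \int[nu]_z (enorm (c + a *: (G z - g)) ^+ 2)%:E <= (enorm c ^+ 2 + a ^+ 2 * v)%:E.
Proof.
move=> mG EG Ev.
pose X i z := (G z 0 i - g 0 i)%R.
have mX i : measurable_fun setT (X i).
  by apply: measurable_funB => //; exact: measurable_cst.
have mu_ : measurable_coords (fun z => G z - g)%R.
  by apply: measurable_coordsD => //; exact: measurable_coords_cst.
have msq := measurable_sqr_enorm mu_.
have isq : (fun z => (enorm (G z - g) ^+ 2)%R) \in Lfun nu 1.
  apply/Lfun1_integrable; apply/integrableP; split.
    exact/measurable_EFinP.
  under eq_integral do rewrite gee0_abs ?lee_fin ?sqr_ge0//.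
  by move: Ev; rewrite unlock => /le_lt_trans; apply; rewrite ltry.
(* Integrability comes from the second moment, through [|X| <= 1 + X^2]. *)
have iX i : X i \in Lfun nu 1.
  apply/Lfun1_integrable.
  apply: (@le_integrable _ _ _ nu setT measurableT (EFin \o X i)
    (EFin \o (cst 1 \+ (fun z => (enorm (G z - g) ^+ 2)))%R)) => //.
  - exact/measurable_EFinP.
  - move=> z _ /=; rewrite lee_fin [leRHS]ger0_norm ?addr_ge0 ?sqr_ge0//.
    have h : (X i z ^+ 2 <= enorm (G z - g) ^+ 2)%R.
      rewrite sqr_enorm_sum (bigD1 i)//= !mxE lerDl sumr_ge0// => j _.
      exact: sqr_ge0.
    rewrite (le_trans _ (lerD (lexx _) h))//.
    have := sqr_ge0 (`|X i z| - 1)%R; rewrite -(real_normK (num_real (X i z))); nra.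
  - apply/Lfun1_integrable; rewrite rpredD//; exact: Lfun_cst.
have EX i : 'E_nu[X i] = 0.
  have : 'E_nu[(X i \+ cst (g 0 i))%R] = (g 0%R i)%:E.
    rewrite -EG; congr expectation; apply/funext => z /=.
    by rewrite /X subrK.
  rewrite expectationD ?Lfun_cst// expectation_cst.
  have := expectation_fin_num (iX i).
  case: ('E_nu[X i]) => // x _ /eqP.
  by rewrite -EFinD eqe -subr_eq0 addrK => /eqP ->.
pose Y := [seq (c 0%R i \o* X i)%R | i <- index_enum 'I_n].
have YL i : (c 0%R i \o* X i)%R \in Lfun nu 1 by exact: Lfun_scale.
have EY : 'E_nu[(fun z => dot c (G z - g))%R] = 0.
  have -> : (fun z => dot c (G z - g))%R = (\sum_(f <- Y) f)%R.
    rewrite /Y big_map; apply/funext => z; rewrite fct_sumE.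
    by apply: eq_bigr => i _; rewrite !mxE mulrC.
  rewrite expectation_sum; last by move=> f /mapP[i _ ->].
  by rewrite /Y big_map big1// => i _; rewrite expectationZl// EX mule0.
have LY : (fun z => dot c (G z - g))%R \in Lfun nu 1.
  have -> : (fun z => dot c (G z - g))%R = (\sum_i (c 0 i \o* X i))%R.
    apply/funext => z; rewrite fct_sumE.
    by apply: eq_bigr => i _; rewrite !mxE mulrC.
  by rewrite rpred_sum.
have -> : \int[nu]_z (enorm (c + a *: (G z - g)) ^+ 2)%:E =
  'E_nu[(cst (enorm c ^+ 2) \+ ((2 * a) \o* (fun z => dot c (G z - g)) \+
    (a ^+ 2) \o* (fun z => enorm (G z - g) ^+ 2)))%R].
  rewrite unlock; apply: eq_integral => z _ /=; congr EFin.
  rewrite !sqr_enorm; move: (G z - g)%R => w; rewrite !dotE (dotC w c); ring.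
have L1 : ((2 * a) \o* (fun z => dot c (G z - g)))%R \in Lfun nu 1.
  exact: Lfun_scale.
have L2 : ((a ^+ 2) \o* (fun z => enorm (G z - g) ^+ 2))%R \in Lfun nu 1.
  exact: Lfun_scale.
rewrite expectationD ?Lfun_cst ?rpredD// expectation_cst expectationD//.
rewrite !expectationZl// EY mule0 add0e EFinD leeD2l// [leRHS]EFinM.
by apply: lee_wpmul2l => //; rewrite lee_fin sqr_ge0.
Qed.

End NoiseSquare.

Section Batch.
Local Open Scope ereal_scope.
Context {R : realType} {n M : nat} (r : 'I_M -> 'rV[R]_n -> R).
Context (dX : measure_display) (Xi : measurableType dX).
Variables (nu : 'I_M -> probability Xi R) (G : 'I_M -> 'rV[R]_n -> Xi -> 'rV[R]_n).
Variable sigma : R.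
Hypothesis G3 : assumption3 r nu G sigma.
Hypothesis cgrad : forall m, continuous (grad (r m)).
Context (dO : measure_display) (Omega : measurableType dO).
Variable P : probability Omega R.
Variables (F : set (set Omega)) (S : {set 'I_M}) (B : nat).
Variables (I : Omega -> {set 'I_M}) (xi : 'I_M -> Omega -> Xi).
Hypothesis sF : Defs.sub_sigma_algebra F.
Hypothesis fresh : fresh_samples P nu F S B I xi.

Definition batch_weight (A : {set 'I_M}) : R :=
  if (A \subset S) && (#|A| == B) then ('C(#|S|, B)%:R^-1)%R else 0%R.

Lemma batch_weight_ge0 A : (0 <= batch_weight A)%R.
Proof. by rewrite /batch_weight; case: ifP. Qed.

Lemma batch_weightE A : P (I @^-1` [set A]) = (batch_weight A)%:E.
Proof.
by have [_ ->] := (let: And3 u _ _ := fresh in u) A; rewrite /batch_weight; case: ifP.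
Qed.

(* The pi-system of the past, the batch and the samples xi m with m in L; it is
   independent of the remaining samples. *)
Definition past_and_samples (L : pred 'I_M) : set (set Omega) :=
  [set E | exists A V (U : 'I_M -> set Xi),
    [/\ F A, forall m, measurable (U m), forall m, ~~ L m -> U m = setT &
     E = A `&` (I @^-1` V) `&` \bigcap_m (xi m @^-1` U m)]].

Lemma measurable_batch V : measurable (I @^-1` V).
Proof.
have -> : I @^-1` V = \bigcup_(A in V) (I @^-1` [set A]).
  apply/seteqP; split => [w Vw|w [A VA IA]]; first by exists (I w).
  by rewrite /= IA.
apply: fin_bigcup_measurable => [|A _]; first exact: finite_finset.
by have [u _ _] := fresh; exact: (u A).1.
Qed.

Lemma past_and_samples_measurable L : past_and_samples L `<=` measurable.
Proof.
move=> _ [A [V [U [FA mU _ ->]]]]; have [_ law _] := fresh.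
apply: measurableI; first apply: measurableI.
- exact: sF.2.
- exact: measurable_batch.
- apply: fin_bigcap_measurable => [|m _]; first exact: finite_finset.
  by rewrite -[X in measurable X]setTI; apply: (law m).1.
Qed.

Lemma pastI : setI_closed F.
Proof.
move=> E E' FE FE'.
have -> : E `&` E' = setT `\` ((setT `\` E) `|` (setT `\` E')).
  by rewrite !setTD setCU !setCK.
have [F0 FC FU] := sF.1.
apply: (FC); rewrite -bigcup2E; apply: FU => -[|[|k]]; rewrite /bigcup2/=.
- exact: FC.
- exact: FC.
- exact: F0.
Qed.

Lemma past_and_samplesI L : setI_closed (past_and_samples L).
Proof.
move=> _ _ [A [V [U [FA mU UT ->]]]] [A' [V' [U' [FA' mU' UT' ->]]]].
exists (A `&` A'), (V `&` V'), (fun m => U m `&` U' m); split.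
- exact: pastI.
- by move=> m; exact: measurableI.
- by move=> m Lm; rewrite UT// UT'// setIT.
- rewrite bigcapI preimage_setI.
  by rewrite setIACA (setIACA A).
Qed.

Lemma past_setT : F setT.
Proof.
have [F0 FC _] := sF.1.
by have := FC _ F0; rewrite setD0.
Qed.

Lemma past_and_samplesT L : past_and_samples L setT.
Proof.
exists setT, setT, (fun=> setT); split => //; first exact: past_setT.
by apply/seteqP; split => w //= _; split.
Qed.

Lemma past_sub_gen L : F `<=` past_and_samples L.
Proof.
move=> A FA; exists A, setT, (fun=> setT); split => //.
by rewrite preimage_setT setIT; apply/seteqP; split => [w Aw|w []//]; split.
Qed.

Lemma batch_in_gen L V : past_and_samples L (I @^-1` V).
Proof.
exists setT, V, (fun=> setT); split => //; first exact: past_setT.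
by rewrite setTI; apply/seteqP; split => [w Aw|w []//]; split.
Qed.

Lemma sample_in_gen (L : pred 'I_M) m U : L m -> measurable U ->
  past_and_samples L (xi m @^-1` U).
Proof.
move=> Lm mU; exists setT, setT, (fun k => if k == m then U else setT); split => //.
- exact: past_setT.
- by move=> k; case: ifP.
- by move=> k Lk; case: eqP => // km; move: Lk; rewrite km Lm.
- rewrite preimage_setT !setTI; apply/seteqP; split => [w Uw k _|w /(_ m Logic.I)].
    by case: eqP => [->|].
  by rewrite eqxx.
Qed.

(** As [m] is outside [L], slot [m] of the event [E] is full. It can receive [U], and the product
    formula for fresh samples covers the intersection. *)
Lemma sample_indep (L : pred 'I_M) m E U : ~~ L m -> past_and_samples L E ->
  measurable U -> P (E `&` xi m @^-1` U) = P E * nu m U.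
Proof.
move=> Lm [A [V [W [FA mW WT ->]]]] mU; have [_ law ind] := fresh.
have lawE k X : measurable X -> P (xi k @^-1` X) = nu k X by exact: (law k).2.
pose W' k := if k == m then U else W k.
have mW' k : measurable (W' k) by rewrite /W'; case: ifP.
have -> : A `&` I @^-1` V `&` \bigcap_m0 xi m0 @^-1` W m0 `&` xi m @^-1` U =
    A `&` I @^-1` V `&` \bigcap_k xi k @^-1` W' k.
  rewrite -setIA; congr (_ `&` _); apply/seteqP; split => [w [Ww Uw] k _|w Ww].
    by rewrite /W'; case: eqP => [->//|_]; exact: Ww.
  have := Ww m Logic.I; rewrite /W' eqxx => Uw; split => // k _.
  by have := Ww k Logic.I; rewrite /W'; case: eqP => // -> _; rewrite WT.
rewrite !ind// (bigD1 m)//= [in RHS](bigD1 m)//= WT// preimage_setT probability_setT.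
rewrite mul1e /W' eqxx lawE// -!muleA; congr (_ * (_ * _)); rewrite muleC.
by congr (_ * _); apply: eq_bigr => k /negbTE ->.
Qed.

Lemma measurable_oracle d (T : measurableType d) m (Y : T -> 'rV[R]_n) (Z : T -> Xi) :
  measurable_coords Y -> measurable_fun setT Z ->
  measurable_coords (fun t => G m (Y t) (Z t)).
Proof.
move=> mY mZ i; have [mG _ _] := G3.
pose borel := g_sigma_algebraType (@open 'rV[R]_n).
have mp : measurable_fun setT (fun t => (Y t, Z t) : borel * Xi).
  exact: measurable_fun_pair (measurable_row mY) mZ.
suff : measurable_fun setT ((fun p : borel * Xi => G m p.1 p.2 0%R i) \o
  (fun t => (Y t, Z t))) by [].
exact: measurableT_comp (mG m i) mp.
Qed.

Lemma measurable_noise d (T : measurableType d) m (Y : T -> 'rV[R]_n) (Z : T -> Xi) :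
  measurable_coords Y -> measurable_fun setT Z ->
  measurable_coords (fun t => G m (Y t) (Z t) - grad (r m) (Y t))%R.
Proof.
move=> mY mZ; apply: measurable_coordsD; first exact: measurable_oracle.
apply: (@measurable_coordsN _ _ _ T (fun t => grad (r m) (Y t))).
exact: (@measurable_coords_comp _ _ _ T (grad (r m)) Y (@cgrad m) mY).
Qed.

Variable Y : Omega -> 'rV[R]_n.
Hypothesis mY : measurable_wrt F Y.

(* On the event I = A the samples are integrated out one at a time. *)
Lemma noise_sum_sqr (A : {set 'I_M}) (C : Omega -> 'rV[R]_n) (a : R) (s : seq 'I_M) :
  measurable_wrt F C -> uniq s ->
  \int[P]_w ((\1_(I @^-1` [set A]) w)%:E * (enorm (C w + a *: \sum_(m <- s)
    (G m (Y w) (xi m w) - grad (r m) (Y w))) ^+ 2)%:E) <=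
  \int[P]_w ((\1_(I @^-1` [set A]) w)%:E * (enorm (C w) ^+ 2)%:E) +
    (batch_weight A * ((size s)%:R * a ^+ 2 * sigma ^+ 2))%:E.
Proof.
move=> mC; elim: s => [_|m s ih /= /andP[ms us]].
  by under eq_integral do rewrite big_nil scaler0 addr0; rewrite !mul0r mulr0 adde0.
have [_ EG vG] := G3; have [_ law _] := fresh.
(* The tail of the sum is measurable for this pi-system, and [xi m] is independent of it because [m]
   is not in [s]. *)
set L : pred 'I_M := [in s]; set Gen := past_and_samples L.
pose OG := g_sigma_algebraType Gen.
pose W w := (C w + a *: \sum_(k <- s) (G k (Y w) (xi k w) - grad (r k) (Y w)))%R.
have FG : F `<=` <<s Gen >>.
  by apply: subset_trans (past_sub_gen L) _; exact: sub_sigma_algebra.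
have mYG := measurable_coords_wrt FG mY.
have mWG : @measurable_coords R n _ OG W.
  apply: measurable_coordsD; first exact: measurable_coords_wrt mC.
  apply: measurable_coordsZ; apply: measurable_coords_sum => k ks.
  apply: (@measurable_noise _ OG) => // _ U mU; rewrite setTI.
  by apply: sub_sigma_algebra; exact: sample_in_gen.
have GM := @past_and_samples_measurable L.
have mid : measurable_fun setT (id : Omega -> OG).
  by move=> _ E mE; rewrite setTI; exact: measurable_gen mE.
have m1 : measurable_fun [set: OG] (\1_(I @^-1` [set A]) : OG -> R).
  by apply: measurable_indic; apply: sub_sigma_algebra; exact: batch_in_gen.
pose H (p : Omega * Xi) := ((\1_(I @^-1` [set A]) p.1)%:E * (enorm (W p.1 +
  a *: (G m (Y p.1) p.2 - grad (r m) (Y p.1))) ^+ 2)%:E).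
have mH : measurable_fun [set: OG * Xi] H.
  apply: emeasurable_funM.
    by apply/measurable_EFinP; exact: (measurableT_comp m1).
  apply/measurable_EFinP; apply: measurable_sqr_enorm.
  apply: measurable_coordsD.
    by move=> i; exact: (measurableT_comp (mWG i)).
  apply: measurable_coordsZ; apply: (@measurable_noise _ (OG * Xi)%type) => //.
  by move=> i; exact: (measurableT_comp (mYG i)).
have H0 p : 0 <= H p.
  by rewrite /H mule_ge0// lee_fin ?sqr_ge0.
have -> : \int[P]_w ((\1_(I @^-1` [set A]) w)%:E *
    (enorm (C w + a *: \sum_(k <- m :: s)
      (G k (Y w) (xi k w) - grad (r k) (Y w))) ^+ 2)%:E) =
    \int[P]_w H (w, xi m w).
  apply: eq_integral => w _; rewrite /H /W/= big_cons; congr (_ * (enorm _ ^+ 2)%:E).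
  by rewrite scalerDr addrA addrAC.
have freeze : \int[P]_w H (w, xi m w) = \int[P]_w \int[nu m]_z H (w, z).
  apply: (integral_freeze GM) => //.
  - exact: past_and_samplesI.
  - exact: past_and_samplesT.
  - exact: (law m).1.
  - by move=> E U; exact: sample_indep.
have mW : measurable_fun setT (fun w => enorm (W w) ^+ 2)%R.
  exact: (measurableT_comp (measurable_sqr_enorm mWG) mid).
have mI : measurable_fun [set: Omega] (\1_(I @^-1` [set A]) : Omega -> R).
  exact: (measurableT_comp m1 mid).
have v0 : (0 <= a ^+ 2 * sigma ^+ 2)%R by rewrite mulr_ge0 ?sqr_ge0.
rewrite freeze; apply: (@le_trans _ _ (\int[P]_w
   ((\1_(I @^-1` [set A]) w)%:E * (enorm (W w) ^+ 2)%:E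
   + (\1_(I @^-1` [set A]) w)%:E * (a ^+ 2 * sigma ^+ 2)%:E))).
  apply: ge0_le_integral => //.
  - by move=> w _; exact: integral_ge0.
  - have mF : measurable_fun [set: OG] (fun w => \int[nu m]_z H (w, z)).
      exact: (@measurable_fun_fubini_tonelli_F _ _ OG).
    exact: (measurableT_comp mF mid).
  - apply: emeasurable_funD; apply: emeasurable_funM; exact/measurable_EFinP.
  - move=> w _; rewrite -muleDr//.
    rewrite /H /= ge0_integralZl//.
    + apply: lee_wpmul2l => //; rewrite -EFinD.
      apply: integral_sqr_enorm_le => [i|i|]; last 2 first.
      * exact: EG.
      * exact: vG.
      exact: (measurable_oracle m (measurable_coords_cst (Y w))
          (@measurable_id _ Xi setT)).
    + apply/measurable_EFinP; apply: measurable_sqr_enorm.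
      apply: measurable_coordsD; first exact: measurable_coords_cst.
      apply: measurable_coordsZ; apply: measurable_coordsD.
        exact: (measurable_oracle m (measurable_coords_cst (Y w))
          (@measurable_id _ Xi setT)).
      exact: measurable_coords_cst.
    + by move=> z _; rewrite lee_fin sqr_ge0.
rewrite ge0_integralD//; last 4 first.
- by move=> w _; rewrite mule_ge0// lee_fin ?sqr_ge0.
- by apply: emeasurable_funM; exact/measurable_EFinP.
- by move=> w _; rewrite mule_ge0// lee_fin ?sqr_ge0.
- by apply: emeasurable_funM; exact/measurable_EFinP.
have -> : \int[P]_w ((\1_(I @^-1` [set A]) w)%:E * (a ^+ 2 * sigma ^+ 2)%:E) =
    (batch_weight A * (a ^+ 2 * sigma ^+ 2))%:E.
  rewrite ge0_integralZr//; last exact/measurable_EFinP.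
  rewrite integral_indic// ?setIT; last exact: measurable_batch.
  by rewrite [RHS]EFinM -(batch_weightE A).
rewrite (le_trans (leeD2r _ (ih us)))// -addeA leeD2l// -EFinD lee_fin.
by rewrite -natr1 le_eqVlt; apply/orP; left; apply/eqP; ring.
Qed.

(** Only an inequality: for [B > #|S|] there is no batch and all weights are 0. *)
Lemma sum_batch_weight_card : (\sum_A batch_weight A * #|A|%:R <= B%:R :> R)%R.
Proof.
have card_batches : (\sum_A batch_weight A <= 1)%R.
  rewrite /batch_weight -big_mkcond/= sumr_const.
  rewrite (_ : #|_| = 'C(#|S|, B)); last first.
    by rewrite -cards_draws; apply: eq_card => A; rewrite !inE.
  rewrite -[leLHS]mulr_natr; have [->|C0] := eqVneq ('C(#|S|, B)) 0%N.
    by rewrite mulr0.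
  by rewrite mulVf// pnatr_eq0.
apply: (@le_trans _ _ (\sum_A batch_weight A * B%:R)%R).
  apply: ler_sum => A _; rewrite /batch_weight.
  by case: ifP => [/andP[_ /eqP ->]//|_]; rewrite !mul0r.
by rewrite -mulr_suml ler_piMl.
Qed.

Lemma past_batch_indep (A : {set 'I_M}) (f : Omega -> R) :
  (forall U, measurable U -> F (f @^-1` U)) -> (forall w, 0 <= f w)%R ->
  \int[P]_w ((\1_(I @^-1` [set A]) w)%:E * (f w)%:E) =
  (batch_weight A)%:E * \int[P]_w (f w)%:E.
Proof.
move=> mf f0; have mA := measurable_batch [set A].
have m1 : measurable_fun setT (\1_(I @^-1` [set A]) : Omega -> R).
  exact: measurable_indic.
pose mu1 := distribution P (mfun_Sub (mem_set m1)).
have [_ _ ind] := fresh.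
have indA (E : set Omega) (U : set R) : F E -> measurable U ->
    P (E `&` \1_(I @^-1` [set A]) @^-1` U) = P E * mu1 U.
  move=> FE mU; rewrite /mu1 /distribution /pushforward/=.
  pose V := [set X : {set 'I_M} | U (\1_[set A] X)].
  have -> : (\1_(I @^-1` [set A]) : Omega -> R) @^-1` U = I @^-1` V.
    by rewrite (_ : (\1_(I @^-1` [set A]) : Omega -> R) =
      (\1_[set A] : {set 'I_M} -> R) \o I).
  have := ind E V (fun=> setT) FE (fun=> measurableT).
  rewrite (_ : \bigcap_m _ = setT); last by apply/seteqP; split.
  rewrite setIT => ->; rewrite big1 ?mule1// => m _.
  by rewrite preimage_setT probability_setT.
(* The indicator of the batch event plays the role of the fresh sample. Freezing wants an integrand
   that is nonnegative for every real second argument, hence the truncation, invisible on the values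
   0 and 1. *)
pose H (p : Omega * R) := maxe 0 (p.2%:E * (f p.1)%:E).
pose OF := g_sigma_algebraType F.
have mfF : measurable_fun [set: OF] f.
  by move=> _ U mU; rewrite setTI; apply: sub_sigma_algebra; exact: mf.
have mH : measurable_fun [set: OF * R] H.
  apply: measurable_maxe; first exact: measurable_cst.
  apply: emeasurable_funM; first exact/measurable_EFinP.
  by apply/measurable_EFinP; exact: (measurableT_comp mfF).
have H0 p : 0 <= H p by rewrite /H le_max lexx.
have HE w z : (0 <= z)%R -> H (w, z) = z%:E * (f w)%:E.
  by move=> z0; rewrite /H max_r//= mule_ge0// lee_fin.
have := @integral_freeze R _ _ Omega R P mu1 F _ H (sF.2) pastI past_setT m1 indA mH H0.
under eq_integral do rewrite HE//.
move=> ->.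
have mf' : measurable_fun setT f.
  by move=> _ U mU; rewrite setTI; apply: sF.2; exact: mf.
have EH w : \int[mu1]_z H (w, z) = (batch_weight A)%:E * (f w)%:E.
  have mHw : measurable_fun setT (fun z => H (w, z)).
    exact: (@measurable_fun_pair2 _ _ _ OF R).
  rewrite (ge0_integral_pushforward m1)//= preimage_setT.
  under eq_integral do rewrite /= HE//.
  rewrite ge0_integralZr ?lee_fin//.
    by rewrite integral_indic// setIT -(batch_weightE A).
  exact/measurable_EFinP.
under eq_integral do rewrite EH.
rewrite ge0_integralZl ?lee_fin ?batch_weight_ge0//.
- exact/measurable_EFinP.
- by move=> w _; rewrite lee_fin.
Qed.

(** Separates the two sources of randomness: the oracle noise is integrated out, and what remains is
    an average over batches of a quantity [C] known from the past, to be bounded pointwise by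
    counting. *)
Lemma batch_second_moment (C : Omega -> {set 'I_M} -> 'rV[R]_n) (a : R) :
  (forall A, measurable_wrt F (C ^~ A)) ->
  \int[P]_w (enorm (C w (I w) + a *: \sum_(m in I w)
    (G m (Y w) (xi m w) - grad (r m) (Y w))) ^+ 2)%:E <=
  \int[P]_w (\sum_A batch_weight A * enorm (C w A) ^+ 2)%:E +
    (a ^+ 2 * B%:R * sigma ^+ 2)%:E.
Proof.
move=> mC.
pose X (A : {set 'I_M}) w := enorm (C w A + a *: \sum_(m in A)
    (G m (Y w) (xi m w) - grad (r m) (Y w)))%R.
have mFT V : measurable_wrt F V -> measurable_coords V.
  by move=> mV i _ U mU; rewrite setTI; apply: sF.2; exact: mV.
have [_ law _] := fresh.
have mX A : measurable_fun setT (fun w => X A w ^+ 2)%R.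
  apply: measurable_sqr_enorm; apply: measurable_coordsD; first exact: mFT.
  apply: measurable_coordsZ.
  under eq_fun do rewrite -big_enum/=.
  apply: measurable_coords_sum => m _.
  by apply: measurable_noise; [exact: mFT | exact: (law m).1].
have m1 A : measurable_fun setT (\1_(I @^-1` [set A]) : Omega -> R).
  by apply: measurable_indic; exact: measurable_batch.
have -> : \int[P]_w (enorm (C w (I w) + a *: \sum_(m in I w)
    (G m (Y w) (xi m w) - grad (r m) (Y w))) ^+ 2)%:E =
    \sum_A \int[P]_w ((\1_(I @^-1` [set A]) w)%:E * (X A w ^+ 2)%:E).
  rewrite -ge0_integral_sum//; last 2 first.
  - by move=> A; apply: emeasurable_funM; exact/measurable_EFinP.
  - by move=> A w _; rewrite mule_ge0// lee_fin ?sqr_ge0.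
  apply: eq_integral => w _; rewrite [RHS](bigD1 (I w))//=.
  rewrite [X in _ = (_ + X)%R]big1 ?addr0 => [|A AI].
    by rewrite indicE mem_set// mul1e.
  by rewrite indicE memNset ?mul0e// => /= IA; rewrite IA eqxx in AI.
apply: (@le_trans _ _ (\sum_A ((batch_weight A)%:E * \int[P]_w (enorm (C w A) ^+ 2)%:E
    + (batch_weight A * (#|A|%:R * a ^+ 2 * sigma ^+ 2))%:E))).
  apply: lee_sum => A _.
  have := noise_sum_sqr A a (mC A) (enum_uniq (mem A)).
  rewrite (@past_batch_indep A (fun w => enorm (C w A) ^+ 2)%R); last 2 first.
  - move=> U mU.
    have mCA : measurable_fun [set: g_sigma_algebraType F]
        (fun w => enorm (C w A) ^+ 2)%R.
      apply: measurable_sqr_enorm; apply: measurable_coords_wrt (mC A).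
      exact: sub_sigma_algebra.
    have := mCA measurableT U mU; rewrite setTI.
    by rewrite /measurable/= sigma_algebra_id//; exact: sF.1.
  - by move=> w; exact: sqr_ge0.
  rewrite -cardE; apply: le_trans; rewrite le_eqVlt; apply/orP; left; apply/eqP.
  by apply: eq_integral => w _; rewrite /X -big_enum.
rewrite big_split/= leeD//.
  rewrite le_eqVlt; apply/orP; left; apply/eqP.
  transitivity (\sum_A \int[P]_w ((batch_weight A)%:E * (enorm (C w A) ^+ 2)%:E)).
    apply: eq_bigr => A _; rewrite ge0_integralZl ?lee_fin ?batch_weight_ge0//.
    - apply/measurable_EFinP; apply: measurable_sqr_enorm; exact: mFT.
    - by move=> w _; rewrite lee_fin sqr_ge0.
  rewrite -ge0_integral_sum//; last 2 first.
  - move=> A; apply: emeasurable_funM; first exact: measurable_cst.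
    by apply/measurable_EFinP; apply: measurable_sqr_enorm; exact: mFT.
  - by move=> A w _; rewrite mule_ge0// lee_fin ?sqr_ge0 ?batch_weight_ge0.
  by apply: eq_integral => w _; rewrite -sumEFin.
rewrite sumEFin lee_fin.
under eq_bigr do rewrite -mulrA mulrA.
rewrite -mulr_suml (_ : a ^+ 2 * B%:R * sigma ^+ 2 =
  B%:R * (a ^+ 2 * sigma ^+ 2))%R; last by ring.
by rewrite ler_wpM2r ?sum_batch_weight_card// mulr_ge0 ?sqr_ge0.
Qed.

End Batch.

(** * Counting the batches that contain one or two given elements *)

Section Batches.
Context {R : realType} {T : finType}.
Implicit Types (S A : {set T}).

Local Notation batches S k := [set A : {set T} | A \subset S & #|A| == k].

(** Removing [m] is a bijection onto the smaller batches avoiding [m]; two applications of it count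
    pairs. *)
Lemma sum_batches_mem S k m (F : {set T} -> R) : m \in S ->
  \sum_(A in batches S k.+1 | m \in A) F A =
  \sum_(A in batches (S :\ m) k) F (m |: A).
Proof.
move=> mS; rewrite (reindex_onto (fun A => m |: A) (fun A => A :\ m)) /=; last first.
  by move=> A /andP[_ mA]; rewrite finset.setD1K.
apply: eq_bigl => A; rewrite !inE eqxx/= andbT.
have [mA|mA] := boolP (m \in A).
  have -> : (A \subset S :\ m) = false.
    by apply/negbTE/negP => /fintype.subsetP/(_ _ mA); rewrite !inE eqxx.
  have -> : ((m |: A) :\ m == A) = false.
    by apply/negbTE/eqP => /setP/(_ m); rewrite !inE eqxx mA.
  by rewrite andbF.
rewrite finset.setU1K// eqxx andbT cardsU1 mA add1n eqSS; congr (_ && _).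
rewrite finset.subUset finset.sub1set mS/=; apply/idP/idP => [AS|].
  apply/fintype.subsetP => x xA; rewrite !inE (fintype.subsetP AS)// andbT.
  by apply: contraNneq mA => <-.
by move/fintype.subset_trans; apply; exact: finset.subsetDl.
Qed.

Lemma count_batches_mem S k m : m \in S ->
  \sum_(A in batches S k.+1) (m \in A)%:R = 'C(#|S|.-1, k)%:R :> R.
Proof.
move=> mS; have -> : \sum_(A in batches S k.+1) (m \in A)%:R =
    \sum_(A in batches S k.+1) (if m \in A then 1 else 0) :> R.
  by apply: eq_bigr => A _; case: (m \in A).
rewrite -big_mkcondr/= (sum_batches_mem _ _ mS) sumr_const cards_draws.
by rewrite (cardsD1 m S) mS.
Qed.

Lemma count_batches_mem2 S k m l : m \in S -> l \in S -> l != m ->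
  \sum_(A in batches S k.+1) ((m \in A) && (l \in A))%:R =
  (if k is k'.+1 then 'C(#|S|.-2, k') else 0)%:R :> R.
Proof.
move=> mS lS lm.
have -> : \sum_(A in batches S k.+1) ((m \in A) && (l \in A))%:R =
    \sum_(A in batches S k.+1 | m \in A) (l \in A)%:R :> R.
  by rewrite [RHS]big_mkcondr; apply: eq_bigr => A _; case: (m \in A).
rewrite (sum_batches_mem _ _ mS).
have -> : \sum_(A in batches (S :\ m) k) (l \in m |: A)%:R =
    \sum_(A in batches (S :\ m) k) (l \in A)%:R :> R.
  by apply: eq_bigr => A _; rewrite !inE (negbTE lm).
have lSm : l \in S :\ m by rewrite !inE lm.
case: k => [|k]; last first.
  by rewrite count_batches_mem// (cardsD1 m S) mS.
rewrite big1// => A; rewrite inE => /andP[_].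
by rewrite cards_eq0 => /eqP ->; rewrite inE.
Qed.

End Batches.

Section SamplingVariance.
Context {R : realType} {n M : nat}.
Variables (S : {set 'I_M}) (B : nat) (v : 'I_M -> 'rV[R]_n) (c : 'rV[R]_n).
Variables b sigma : R.

Local Notation weight A :=
  (if (A \subset S) && (#|A| == B) then 'C(#|S|, B)%:R^-1 else 0).

(* The last three hypotheses cover both batches: over all devices the deviations
   v m sum to 0, while over the devices other than the server they sum to minus
   that of the server, and then c = 0. *)
Lemma sampling_variance : (0 < B)%N -> (B <= #|S|)%N ->
  (forall m, m \in S -> enorm (v m) ^+ 2 <= sigma ^+ 2) ->
  enorm (\sum_(m in S) v m) ^+ 2 <= sigma ^+ 2 ->
  dot c (\sum_(m in S) v m) = 0 ->
  \sum_(A : {set 'I_M}) weight A * enorm (c + b *: \sum_(m in A) v m) ^+ 2 <=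
    enorm c ^+ 2 + 2 * b ^+ 2 * B%:R * sigma ^+ 2.
Proof.
case: B => // k _ kS vs Vs cV.
pose batches := [set A : {set 'I_M} | A \subset S & #|A| == k.+1].
set V := \sum_(m in S) v m in Vs cV *.
pose K : R := 'C(#|S|, k.+1)%:R.
have K0 : 0 < K by rewrite ltr0n bin_gt0.
have -> : \sum_(A : {set 'I_M}) (if (A \subset S) && (#|A| == k.+1) then K^-1 else 0)
      * enorm (c + b *: \sum_(m in A) v m) ^+ 2 =
    K^-1 * \sum_(A in batches) enorm (c + b *: \sum_(m in A) v m) ^+ 2.
  rewrite mulr_sumr [RHS]big_mkcond; apply: eq_bigr => A _; rewrite inE.
  by case: ifP => // _; rewrite mul0r.
pose N1 : R := 'C(#|S|.-1, k)%:R.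
pose N2 : R := (if k is k'.+1 then 'C(#|S|.-2, k') else 0)%:R.
have S0 : (0 < #|S|)%N by exact: leq_trans kS.
have inS A m : A \in batches -> m \in A -> m \in S.
  by rewrite inE => /andP[/fintype.subsetP + _]; apply.
have sumE A : A \in batches -> \sum_(m in A) v m = \sum_(m in S) (m \in A)%:R *: v m.
  move=> AB; rewrite [LHS]big_mkcond [RHS]big_mkcond; apply: eq_bigr => m _.
  case: ifPn => mA; first by rewrite (inS A)// scale1r.
  by rewrite scale0r; case: ifP.
have s1 : \sum_(A in batches) dot c (\sum_(m in A) v m) = 0.
  have -> : \sum_(A in batches) dot c (\sum_(m in A) v m) =
      \sum_(A in batches) \sum_(m in S) (m \in A)%:R * dot c (v m).
    apply: eq_bigr => A AB; rewrite sumE// dotC dot_suml; apply: eq_bigr => m _.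
    by rewrite dotZl dotC.
  rewrite exchange_big/= (eq_bigr (fun m => N1 * dot c (v m))); last first.
    by move=> m mS; rewrite -mulr_suml count_batches_mem.
  rewrite -mulr_sumr; move: cV; rewrite dotC dot_suml.
  by under eq_bigr do rewrite dotC; move=> ->; rewrite mulr0.
(* Each diagonal product occurs in [N1] batches and each off-diagonal one in [N2]; completing the
   off-diagonal sum by its diagonal makes [|V|^2] appear. *)
have s2 : \sum_(A in batches) enorm (\sum_(m in A) v m) ^+ 2 =
    (N1 - N2) * \sum_(m in S) enorm (v m) ^+ 2 + N2 * enorm V ^+ 2.
  have -> : \sum_(A in batches) enorm (\sum_(m in A) v m) ^+ 2 =
      \sum_(A in batches) \sum_(m in S) \sum_(l in S)
      ((m \in A) && (l \in A))%:R * dot (v m) (v l).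
    apply: eq_bigr => A AB; rewrite sqr_enorm sumE// dot_suml; apply: eq_bigr => m _.
    rewrite dotZl dotC dot_suml mulr_sumr; apply: eq_bigr => l _.
    by rewrite dotZl dotC mulrA -natrM mulnb.
  rewrite exchange_big/= (eq_bigr (fun m =>
    (N1 - N2) * enorm (v m) ^+ 2 + N2 * dot (v m) V)); last first.
    move=> m mS; rewrite exchange_big/= (bigD1 m)//= -mulr_suml.
    have -> : \sum_(A in batches) ((m \in A) && (m \in A))%:R = N1.
      by under eq_bigr do rewrite andbb; exact: count_batches_mem.
    rewrite -sqr_enorm.
    rewrite (eq_bigr (fun l => N2 * dot (v m) (v l))); last first.
      by move=> l /andP[lS lm]; rewrite -mulr_suml count_batches_mem2.
    rewrite dotC /V dot_suml [in RHS](bigD1 m)//= -mulr_sumr sqr_enorm.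
    under [in RHS]eq_bigr do rewrite dotC.
    by rewrite -/N1; ring.
  by rewrite big_split/= -!mulr_sumr sqr_enorm {3}/V dot_suml.
have N20 : 0 <= N2 by rewrite ler0n.
have N12 : N2 <= N1.
  rewrite ler_nat; move: kS; case: (k) => [|k']//.
  by case: #|S| => [|[|p]]//= _; rewrite binS leq_addl.
have N1K : N1 <= K.
  by rewrite ler_nat; case: #|S| S0 => // p _; rewrite binS leq_addl.
have nN1 : #|S|%:R * N1 = k.+1%:R * K.
  by rewrite -!natrM mul_bin_diag.
(* The factor 2: the diagonal part and the part in [|V|^2] each cost at most [(k + 1) K sigma^2]. *)
have s3 : \sum_(A in batches) enorm (\sum_(m in A) v m) ^+ 2 <=
    2 * k.+1%:R * K * sigma ^+ 2.
  have vS : \sum_(m in S) enorm (v m) ^+ 2 <= #|S|%:R * sigma ^+ 2.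
    by rewrite mulr_natl -sumr_const; apply: ler_sum.
  have t1 : (N1 - N2) * \sum_(m in S) enorm (v m) ^+ 2 <=
      N1 * (#|S|%:R * sigma ^+ 2).
    rewrite (le_trans (ler_wpM2l _ vS)) ?subr_ge0// ler_wpM2r ?gerBl//.
    by rewrite mulr_ge0 ?sqr_ge0.
  have t2 : N2 * enorm V ^+ 2 <= k.+1%:R * K * sigma ^+ 2.
    rewrite (le_trans (ler_wpM2l _ Vs))// ler_wpM2r ?sqr_ge0//.
    by rewrite (le_trans N12)// (le_trans N1K)// ler_peMl ?ler1n ?(ltW K0).
  have t3 : N1 * (#|S|%:R * sigma ^+ 2) = k.+1%:R * K * sigma ^+ 2.
    by rewrite -nN1; ring.
  by rewrite s2; move: t1 t2; rewrite t3; lra.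
have -> : \sum_(A in batches) enorm (c + b *: \sum_(m in A) v m) ^+ 2 =
    K * enorm c ^+ 2 + 2 * b * \sum_(A in batches) dot c (\sum_(m in A) v m)
    + b ^+ 2 * \sum_(A in batches) enorm (\sum_(m in A) v m) ^+ 2.
  rewrite [2 * b * _]mulr_sumr [b ^+ 2 * _]mulr_sumr.
  have -> : K * enorm c ^+ 2 = \sum_(A in batches) enorm c ^+ 2.
    by rewrite sumr_const cards_draws mulr_natl.
  rewrite -!big_split/=; apply: eq_bigr => A _.
  by rewrite !sqr_enorm !dotE (dotC _ c); ring.
rewrite s1 mulr0 addr0 mulrDr mulKf ?gt_eqF// lerD2l.
rewrite ler_pdivrMl//.
rewrite (le_trans (ler_wpM2l (sqr_ge0 b) s3))// le_eqVlt; apply/orP; left; apply/eqP.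
by ring.
Qed.

End SamplingVariance.

(** * One iteration *)

Section BatchShift.
Context {R : realType} {n M : nat}.
Variables (A : {set 'I_M}) (w : 'I_M -> 'rV[R]_n).
Hypothesis A0 : #|A| != 0%N.

Lemma sum_batch_shift (u : 'rV[R]_n) :
  \sum_(m in A) (w m - u) = \sum_(m in A) w m - #|A|%:R *: u.
Proof. by rewrite sumrB sumr_const scaler_nat. Qed.

(** The reference [v], in use the server gradient, cancels; only deviations from [u], the full
    gradient, remain. *)
Lemma batch_mean_recenter (u v : 'rV[R]_n) :
  u - v - #|A|%:R^-1 *: \sum_(m in A) (w m - v) =
  0 + (- #|A|%:R^-1) *: \sum_(m in A) (w m - u).
Proof.
rewrite !sum_batch_shift; move: (\sum_(m in A) w m) => S.
have A1 : #|A|%:R != 0 :> R by rewrite pnatr_eq0.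
by apply/rowP => i; rewrite !mxE; field.
Qed.

Lemma batch_step_recenter (y z u : 'rV[R]_n) (e : R) :
  y - (e / #|A|%:R) *: \sum_(m in A) w m - z =
  (y - e *: u - z) + (- (e / #|A|%:R)) *: \sum_(m in A) (w m - u).
Proof.
rewrite !sum_batch_shift; move: (\sum_(m in A) w m) => S.
have A1 : #|A|%:R != 0 :> R by rewrite pnatr_eq0.
by apply/rowP => i; rewrite !mxE; field.
Qed.

End BatchShift.

Lemma measurable_wrt_coords {R : realType} {n : nat} d (Omega : measurableType d)
    (F : set (set Omega)) (V : Omega -> 'rV[R]_n) :
  Defs.sub_sigma_algebra F -> @measurable_coords R n _ (g_sigma_algebraType F) V ->
  measurable_wrt F V.
Proof.
move=> sF mV i U mU; have := mV i measurableT U mU; rewrite setTI.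
by rewrite /measurable/= sigma_algebra_id//; exact: sF.1.
Qed.

Lemma integral_probability_cst {R : realType} d (T : measurableType d)
  (P : probability T R) (a : R) : (\int[P]_w a%:E = a%:E)%E.
Proof. by have := expectation_cst P a; rewrite unlock. Qed.

Section StepParams.
Context {R : realType}.
Variables (mu delta theta : R).
Hypotheses (mu0 : 0 < mu) (mud : mu < delta) (th0 : 0 < theta)
  (thd : theta <= (3 * delta)^-1).

Lemma tau_of_gt0 : 0 < tau_of mu theta.
Proof. by rewrite divr_gt0// sqrtr_gt0 mulr_gt0. Qed.

Lemma theta_tau : theta = 9 * tau_of mu theta ^+ 2 / mu.
Proof.
rewrite /tau_of expr_div_n sqr_sqrtr ?mulr_ge0 ?ltW//.
by field; rewrite gt_eqF.
Qed.

Lemma eta_tau : eta_of mu theta = 3 * tau_of mu theta / mu.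
Proof.
have t0 := tau_of_gt0; have := tau_div_eta mu0 mud th0 thd.
have [->|e0 E] := eqVneq (eta_of mu theta) 0.
  by rewrite invr0 mulr0 => /eqP; rewrite lt_eqF// divr_gt0.
have -> : tau_of mu theta = mu / 3 * eta_of mu theta by rewrite -E; field.
by field; rewrite gt_eqF.
Qed.

Lemma tau_of_le_half : tau_of mu theta <= 2^-1.
Proof.
have d0 : 0 < delta by exact: lt_trans mud.
have t0 := tau_of_gt0.
have h : mu * theta <= 1.
  have : delta * theta <= 3^-1.
    have -> : 3^-1 = delta * (3 * delta)^-1 :> R by field; rewrite gt_eqF.
    by rewrite ler_pM2l.
  have : mu * theta <= delta * theta by rewrite ler_wpM2r// ltW.
  lra.
have := theta_tau => E; have {}E : mu * theta = 9 * tau_of mu theta ^+ 2.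
  by rewrite {1}E; field; rewrite gt_eqF.
by move: (tau_of mu theta) E t0 => t E t0; rewrite leNgt; apply/negP => t2; nra.
Qed.

End StepParams.

Section Step.
Local Open Scope ereal_scope.
Context {R : realType} {d M B : nat} (hM : (0 < M)%N) (r : 'I_M -> 'rV[R]_d -> R).
Variables (xstar : 'rV[R]_d) (mu L1 delta sigma_sim sigma_noise : R).
Context (dX : measure_display) (Xi : measurableType dX).
Variables (nu : 'I_M -> probability Xi R) (G : 'I_M -> 'rV[R]_d -> Xi -> 'rV[R]_d).
Hypotheses (B0 : (0 < B)%N) (BM : (B < M)%N).
Hypothesis dr : forall m, twice_differentiable (r m).
Hypothesis min : is_minimizer (average r) xstar.
Hypothesis A1 : assumption1 hM r mu L1.
Hypothesis A2 : assumption2 r xstar delta sigma_sim 0.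
Hypothesis A3 : assumption3 r nu G sigma_noise.
Hypothesis mud : (mu < delta)%R.

Local Notation f := (average r).
Local Notation h := (r (server hM)).

(** Bounds the mean squared error of [s_k] and, after scaling by [eta ^+ 2], the contribution of the
    error of [t_k]. The 2 is that of [sampling_variance]. *)
Definition batch_noise : R := (2 * sigma_sim ^+ 2 + sigma_noise ^+ 2) / B%:R.

Lemma continuous_grad g : twice_differentiable g -> continuous (@grad R d g).
Proof. by move=> [_ dg] x; exact: differentiable_continuous. Qed.

Lemma sum_grad x : (\sum_m grad (r m) x = M%:R *: grad f x)%R.
Proof.
rewrite grad_average => [|m]; last exact: (dr m).1.
by rewrite scalerA mulfV ?scale1r// pnatr_eq0 -lt0n.
Qed.

Lemma similarity m x : (enorm (grad (r m) x - grad f x) ^+ 2 <= sigma_sim ^+ 2)%R.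
Proof. by have [_ _ _ /(_ m x)[_]] := A2; rewrite mulr0 addr0. Qed.

Lemma sum_deviation x : (\sum_(m in [set: 'I_M]%SET) (grad (r m) x - grad f x) = 0)%R.
Proof.
under eq_bigl do rewrite inE.
by rewrite sumrB sum_grad sumr_const card_ord scaler_nat subrr.
Qed.

Lemma sum_deviation_others x :
  (\sum_(m in [set~ server hM]%SET) (grad (r m) x - grad f x) =
  - (grad h x - grad f x))%R.
Proof.
have := sum_deviation x; rewrite (bigD1 (server hM)) ?inE//= addrC => /eqP.
rewrite addr_eq0 => /eqP <-.
by apply: eq_bigl => m; rewrite !inE.
Qed.

Context (dO : measure_display) (Omega : measurableType dO) (P : probability Omega R).

Lemma server_estimator_error (F : set (set Omega)) (I : Omega -> {set 'I_M})
    (xi : 'I_M -> Omega -> Xi) (g : Omega -> 'rV[R]_d) :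
  Defs.sub_sigma_algebra F -> measurable_wrt F g ->
  fresh_samples P nu F [set~ server hM]%SET B I xi ->
  \int[P]_w (enorm (grad f (g w) - grad h (g w) -
    server_estimator hM r G B (I w) (xi ^~ w) (g w)) ^+ 2)%:E <= batch_noise%:E.
Proof.
move=> sF mg fr.
pose C w (A : {set 'I_M}) := (grad f (g w) - grad h (g w) -
  B%:R^-1 *: \sum_(m in A) (grad (r m) (g w) - grad h (g w)))%R.
have mgF : @measurable_coords R d _ (g_sigma_algebraType F) g.
  by apply: measurable_coords_wrt mg; exact: sub_sigma_algebra.
have mgr q : twice_differentiable q ->
    @measurable_coords R d _ (g_sigma_algebraType F) (fun w => grad q (g w)).
  move=> dq; exact: (measurable_coords_comp (@continuous_grad _ dq) mgF).
have mC A : measurable_wrt F (C ^~ A).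
  apply: measurable_wrt_coords => //; apply: measurable_coordsD.
    apply: measurable_coordsD; first exact: mgr (twice_differentiable_average dr).
    by apply: measurable_coordsN; exact: mgr.
  apply: measurable_coordsN; apply: measurable_coordsZ.
  under eq_fun do rewrite -big_enum/=.
  apply: measurable_coords_sum => m _; apply: measurable_coordsD; first exact: mgr.
  by apply: measurable_coordsN; exact: mgr.
have cg m : continuous (grad (r m)) by exact: continuous_grad.
have := batch_second_moment A3 cg sF fr mg (- B%:R^-1)%R mC.
have -> : \int[P]_w (enorm (C w (I w) + (- B%:R^-1) *: \sum_(m in I w)
    (G m (g w) (xi m w) - grad (r m) (g w))) ^+ 2)%:E =
  \int[P]_w (enorm (grad f (g w) - grad h (g w) -
    server_estimator hM r G B (I w) (xi ^~ w) (g w)) ^+ 2)%:E.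
  apply: eq_integral => w _; congr (enorm _ ^+ 2)%:E.
  rewrite /C /server_estimator scaleNr -addrA -opprD -scalerDr -big_split/=.
  congr (_ - _ *: _)%R; apply: eq_bigr => m _.
  by rewrite addrC addrA subrK.
move/le_trans; apply.
have B0' : (0 < B%:R :> R)%R by rewrite ltr0n.
apply: (@le_trans _ _ (\int[P]_w (2 * sigma_sim ^+ 2 / B%:R)%:E +
  ((- B%:R^-1) ^+ 2 * B%:R * sigma_noise ^+ 2)%:E)); last first.
  rewrite integral_probability_cst -EFinD lee_fin le_eqVlt /batch_noise.
  by apply/orP; left; apply/eqP; field; rewrite gt_eqF.
rewrite leeD2r//; apply: ge0_le_integral => //.
- move=> w _; rewrite lee_fin sumr_ge0// => A _.
  by rewrite mulr_ge0 ?sqr_ge0 ?batch_weight_ge0.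
- apply/measurable_EFinP; apply: measurable_sum => A; apply: measurable_funM => //.
  apply: measurable_sqr_enorm => i _ U mU; rewrite setTI; apply: sF.2.
  exact: mC.
move=> w _; rewrite lee_fin.
have cardS : #|[set~ server hM]%SET| = M.-1 by rewrite cardsC1 card_ord.
have := @sampling_variance R d M [set~ server hM]%SET B
  (fun m => grad (r m) (g w) - grad f (g w))%R 0%R (- B%:R^-1)%R sigma_sim B0.
rewrite cardS -ltnS prednK// sum_deviation_others enormN dot0l.
move=> /(_ BM (fun m _ => similarity m _) (similarity _ _) erefl).
have -> : (enorm (0%R : 'rV[R]_d) ^+ 2 + 2 * (- B%:R^-1) ^+ 2 * B%:R * sigma_sim ^+ 2 =
    2 * sigma_sim ^+ 2 / B%:R)%R.
  by rewrite sqr_enorm dot0l; field; rewrite gt_eqF.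
apply: le_trans; apply: ler_sum => A _; rewrite /batch_weight cardS.
case: ifPn => [/andP[_ /eqP cA]|]; last by rewrite !mul0r.
rewrite le_eqVlt; apply/orP; left; apply/eqP; congr (_ * enorm _ ^+ 2)%R.
have A0 : #|A| != 0%N by rewrite cA -lt0n.
have := batch_mean_recenter (fun m => grad (r m) (g w)) A0
  (grad f (g w)) (grad h (g w)).
by rewrite cA.
Qed.

Definition potential (x xf : 'rV[R]_d) : R :=
  (mu / 3 * enorm (x - xstar) ^+ 2 + 2 * (f xf - f xstar))%R.

Lemma potential_ge0 x xf : (0 <= potential x xf)%R.
Proof.
have [mu0 _ _ _] := A1.
apply: addr_ge0; first by rewrite mulr_ge0 ?sqr_ge0 ?divr_ge0// ltW.
by rewrite mulr_ge0 ?subr_ge0//; exact: min.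
Qed.

Lemma measurable_potential (x xf : Omega -> 'rV[R]_d) :
  measurable_coords x -> measurable_coords xf ->
  measurable_fun setT (fun w => potential (x w) (xf w)).
Proof.
move=> mx mxf.
have mf : measurable_fun setT (fun w => f (xf w)).
  apply: (@measurable_continuous_row _ _ _ _ xf f) => // z.
  by apply: differentiable_continuous; exact: (twice_differentiable_average dr).1.
apply: measurable_funD; apply: measurable_funM => //.
  by apply: measurable_sqr_enorm; apply: measurable_coordsD.
by apply: measurable_funB.
Qed.

Lemma expected_step (theta : R) (F H : set (set Omega))
    (x xf y x' : Omega -> 'rV[R]_d) (I J : Omega -> {set 'I_M})
    (xi xi' : 'I_M -> Omega -> Xi) :
  (0 < theta)%R -> (theta <= (3 * delta)^-1)%R ->
  let tau := tau_of mu theta in let eta := eta_of mu theta in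
  let g w := extrapolation tau (x w) (xf w) in
  Defs.sub_sigma_algebra F -> Defs.sub_sigma_algebra H -> F `<=` H ->
  measurable_wrt F x -> measurable_wrt F xf -> measurable_wrt H y ->
  measurable_coords x' ->
  fresh_samples P nu F [set~ server hM]%SET B I xi ->
  fresh_samples P nu H [set: 'I_M]%SET B J xi' ->
  (forall w, inexact_prox h delta theta
     (server_estimator hM r G B (I w) (xi ^~ w) (g w)) (g w) (y w)) ->
  (forall w, x' w = x w + (eta * alpha_of mu) *: (y w - x w)
     - eta *: full_estimator G B (J w) (xi' ^~ w) (y w))%R ->
  \int[P]_w (potential (x' w) (y w))%:E <=
  (1 - tau)%:E * \int[P]_w (potential (x w) (xf w))%:E +
    (30 * tau ^+ 2 / mu * batch_noise)%:E.
Proof.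
move=> th0 thd tau eta g sF sH FH mx mxf my mx' frI frJ prox x'E.
have [mu0 sc ch _] := A1; have [d0 _ _ A2'] := A2.
have t0 : (0 < tau)%R by exact: tau_of_gt0.
have t2 : (tau <= 2^-1)%R by exact: tau_of_le_half mu0 mud th0 thd.
have thE : theta = (9 * tau ^+ 2 / mu)%R by exact: theta_tau.
have etaE : eta = (3 * tau / mu)%R by exact: eta_tau mu0 mud th0 thd.
have etaA : (eta * alpha_of mu = tau)%R.
  by rewrite etaE /alpha_of; field; rewrite gt_eqF.
have B0' : (0 < B%:R :> R)%R by rewrite ltr0n.
have daverage := twice_differentiable_average dr.
have FHg : F `<=` <<s H >> by apply: subset_trans FH _; exact: sub_sigma_algebra.
have HHg : H `<=` <<s H >> by exact: sub_sigma_algebra.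
have mxH := measurable_coords_wrt FHg mx.
have myH := measurable_coords_wrt HHg my.
have toO (V : Omega -> 'rV[R]_d) K :
    Defs.sub_sigma_algebra K -> measurable_wrt K V -> measurable_coords V.
  by move=> sK mV i _ U mU; rewrite setTI; apply: sK.2; exact: mV.
have mxO := toO _ _ sF mx; have mxfO := toO _ _ sF mxf; have myO := toO _ _ sH my.
have mgr q : twice_differentiable q ->
    @measurable_coords R d _ (g_sigma_algebraType H) (fun w => grad q (y w)).
  move=> dq; exact: (measurable_coords_comp (@continuous_grad _ dq) myH).
pose n w := (enorm (grad f (g w) - grad h (g w) -
    server_estimator hM r G B (I w) (xi ^~ w) (g w)) ^+ 2)%R.
have mg : measurable_wrt F g.
  apply: measurable_wrt_coords => //; apply: measurable_coordsD;
    by apply: measurable_coordsZ; exact: measurable_coords_wrt.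
have n_le : \int[P]_w (n w)%:E <= batch_noise%:E.
  exact: server_estimator_error sF mg frI.
pose c w := (x w + tau *: (y w - x w) - (3 * tau / mu) *: grad f (y w) - xstar)%R.
(* [c] is the update with the full gradient, [C] the one with exact gradients averaged over a batch:
   the passage from [x'] to [C] removes the oracle noise, that from [C] to [c] the sampling
   error. *)
pose C w (A : {set 'I_M}) := (x w + tau *: (y w - x w)
  - (eta / B%:R) *: \sum_(m in A) grad (r m) (y w) - xstar)%R.
have mC A : measurable_wrt H (C ^~ A).
  apply: measurable_wrt_coords => //; apply: measurable_coordsD;
    last exact: measurable_coords_cst.
  apply: measurable_coordsD.
    apply: measurable_coordsD => //; apply: measurable_coordsZ.
    by apply: measurable_coordsD => //; exact: measurable_coordsN.
  apply: measurable_coordsN; apply: measurable_coordsZ.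
  under eq_fun do rewrite -big_enum/=.
  by apply: measurable_coords_sum => m _; exact: mgr.
have mc : measurable_coords c.
  apply: (toO _ H) => //; apply: measurable_wrt_coords => //.
  apply: measurable_coordsD; last exact: measurable_coords_cst.
  apply: measurable_coordsD.
    apply: measurable_coordsD => //; apply: measurable_coordsZ.
    by apply: measurable_coordsD => //; exact: measurable_coordsN.
  by apply: measurable_coordsN; apply: measurable_coordsZ; exact: mgr.
have cg m : continuous (grad (r m)) by exact: continuous_grad.
have x'_le : \int[P]_w (enorm (x' w - xstar) ^+ 2)%:E <=
    \int[P]_w (enorm (c w) ^+ 2)%:E + (eta ^+ 2 * batch_noise)%:E.
  have := batch_second_moment A3 cg sH frJ my (- (eta / B%:R))%R mC.
  have -> : \int[P]_w (enorm (C w (J w) + (- (eta / B%:R)) *: \sum_(m in J w)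
      (G m (y w) (xi' m w) - grad (r m) (y w))) ^+ 2)%:E =
      \int[P]_w (enorm (x' w - xstar) ^+ 2)%:E.
    apply: eq_integral => w _; congr (enorm _ ^+ 2)%:E.
    rewrite x'E etaA /C /full_estimator sumrB scalerA.
    by apply/rowP => i; rewrite !mxE; ring.
  move/le_trans; apply.
  apply: (@le_trans _ _ (\int[P]_w ((enorm (c w) ^+ 2)%:E +
    (2 * eta ^+ 2 * sigma_sim ^+ 2 / B%:R)%:E) +
    ((- (eta / B%:R)) ^+ 2 * B%:R * sigma_noise ^+ 2)%:E)); last first.
    rewrite ge0_integralD//; last 2 first.
    - exact/measurable_EFinP/measurable_sqr_enorm.
    - by move=> *; rewrite lee_fin divr_ge0// mulr_ge0 ?sqr_ge0// mulr_ge0 ?sqr_ge0.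
      rewrite integral_probability_cst -addeA -EFinD leeD2l// lee_fin.
      rewrite le_eqVlt /batch_noise.
      by apply/orP; left; apply/eqP; field; rewrite gt_eqF.
    by move=> w _; rewrite lee_fin sqr_ge0.
  rewrite leeD2r//; apply: ge0_le_integral => //.
  - move=> w _; rewrite lee_fin sumr_ge0// => A _.
    by rewrite mulr_ge0 ?sqr_ge0 ?batch_weight_ge0.
  - apply/measurable_EFinP; apply: measurable_sum => A; apply: measurable_funM => //.
    by apply: measurable_sqr_enorm; exact: toO (mC A).
  - by apply: emeasurable_funD => //; exact/measurable_EFinP/measurable_sqr_enorm.
  move=> w _; rewrite -EFinD lee_fin.
  have := @sampling_variance R d M [set: 'I_M]%SET B
    (fun m => grad (r m) (y w) - grad f (y w))%R (c w) (- (eta / B%:R))%R sigma_sim B0.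
  rewrite cardsT card_ord sum_deviation sqr_enorm dot0l sqr_ge0 dotC dot0l.
  move=> /(_ (ltnW BM) (fun m _ => similarity m _) isT erefl).
  have -> : (2 * (- (eta / B%:R)) ^+ 2 * B%:R * sigma_sim ^+ 2 =
      2 * eta ^+ 2 * sigma_sim ^+ 2 / B%:R)%R by field; rewrite gt_eqF.
  apply: le_trans; apply: ler_sum => A _; rewrite /batch_weight cardsT card_ord.
  case: ifPn => [/andP[_ /eqP cA]|]; last by rewrite !mul0r.
  rewrite le_eqVlt; apply/orP; left; apply/eqP; congr (_ * enorm _ ^+ 2)%R.
  have A0 : #|A| != 0%N by rewrite cA -lt0n.
  have := batch_step_recenter (fun m => grad (r m) (y w)) A0
    (x w + tau *: (y w - x w))%R xstar (grad f (y w)) eta.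
  by rewrite cA /C /c -etaE.
(* This inequality holds for every outcome, so the dependence of [y] on the error of [s_k] is
   harmless. *)
have path w : (mu / 3 * enorm (c w) ^+ 2 + 2 * (f (y w) - f xstar) <=
    (1 - tau) * potential (x w) (xf w) + 3 * theta * n w)%R.
  have step := @descent_step R d f (x w) (xf w) (y w) xstar mu tau (n w) mu0 t0 t2 sc.
  rewrite /= -thE in step; apply: step.
  apply: (prox_step d0 th0 thd ch _ _ (prox w)).
    exact: (dr _).1.
  apply: grad_similarity; [exact: (dr _).2|exact: daverage.2|].
  by move=> z; exact: (A2' _ z).1.
have mfy : measurable_fun setT (fun w => 2 * (f (y w) - f xstar))%R.
  apply: measurable_funM => //; apply: measurable_funB => //.
  apply: (@measurable_continuous_row _ _ _ _ y f) => // z.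
  by apply: differentiable_continuous; exact: daverage.1.
have fy0 w : (0 <= 2 * (f (y w) - f xstar))%R.
  by rewrite mulr_ge0 ?subr_ge0//; exact: min.
have m30 : (0 <= mu / 3)%R by rewrite divr_ge0// ltW.
have split_int (z : Omega -> 'rV[R]_d) : measurable_coords z ->
    \int[P]_w (mu / 3 * enorm (z w) ^+ 2 + 2 * (f (y w) - f xstar))%:E =
    (mu / 3)%:E * \int[P]_w (enorm (z w) ^+ 2)%:E
      + \int[P]_w (2 * (f (y w) - f xstar))%:E.
  move=> mz; have mz2 := measurable_sqr_enorm mz.
  under eq_integral do rewrite EFinD EFinM.
  rewrite ge0_integralD//; last 4 first.
  - by move=> w _; rewrite -EFinM lee_fin mulr_ge0// sqr_ge0.
  - by apply: emeasurable_funM => //; exact/measurable_EFinP.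
  - by move=> w _; rewrite lee_fin.
  - exact/measurable_EFinP.
  rewrite ge0_integralZl ?lee_fin//; first exact/measurable_EFinP.
  by move=> w _; rewrite lee_fin sqr_ge0.
have mx'c : measurable_coords (fun w => x' w - xstar)%R.
  by apply: measurable_coordsD => //; exact: measurable_coords_cst.
have mn : measurable_fun setT n.
  have [_ law _] := frI.
  have mgO := toO _ _ sF mg.
  have mgO' q : twice_differentiable q -> measurable_coords (fun w => grad q (g w)).
    move=> dq; exact: (measurable_coords_comp (@continuous_grad _ dq) mgO).
  apply: measurable_sqr_enorm; apply: measurable_coordsD.
    apply: measurable_coordsD; first exact: mgO'.
    by apply: measurable_coordsN; exact: mgO'.
  apply: measurable_coordsN.
  suff mO A : measurable_coords (fun w => server_estimator hM r G B A (xi ^~ w) (g w)).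
    have mI A : measurable_fun [set: Omega] (\1_(I @^-1` [set A]) : Omega -> R).
      by apply: measurable_indic; exact: measurable_batch frI _.
    (* Measurability with a random index set: a finite sum over the possible batches, cut by
       indicators. *)
    have -> : (fun w => server_estimator hM r G B (I w) (xi ^~ w) (g w)) =
        (fun w => \sum_A \1_(I @^-1` [set A]) w *:
          server_estimator hM r G B A (xi ^~ w) (g w))%R.
      apply/funext => w; rewrite (bigD1 (I w))//= big1 ?addr0 => [|A AI].
        by rewrite indicE mem_set// scale1r.
      by rewrite indicE memNset ?scale0r// => /= IA; rewrite IA eqxx in AI.
    apply: measurable_coords_sum => A _ i.
    under eq_fun do rewrite mxE.
    by apply: measurable_funM => //; exact: mO.
  apply: measurable_coordsZ; under eq_fun do rewrite -big_enum/=.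
  apply: measurable_coords_sum => m _; apply: measurable_coordsD.
    by apply: (measurable_oracle A3) => //; exact: (law m).1.
  by apply: measurable_coordsN; exact: mgO'.
have noise0 : (0 <= batch_noise)%R.
  by rewrite divr_ge0 ?addr_ge0 ?sqr_ge0// mulr_ge0 ?sqr_ge0.
have mpot := measurable_potential mxO mxfO.
have pot0 w := potential_ge0 (x w) (xf w).
rewrite split_int//.
apply: (@le_trans _ _ ((mu / 3)%:E * (\int[P]_w (enorm (c w) ^+ 2)%:E
   + (eta ^+ 2 * batch_noise)%:E) + \int[P]_w (2 * (f (y w) - f xstar))%:E)).
  by rewrite leeD2r//; apply: lee_wpmul2l => //; rewrite lee_fin.
rewrite ge0_muleDr; last 2 first.
- by apply: integral_ge0 => w _; rewrite lee_fin sqr_ge0.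
- by rewrite lee_fin mulr_ge0 ?sqr_ge0.
rewrite addeAC -(split_int c)//.
apply: (@le_trans _ _ (\int[P]_w ((1 - tau)%:E * (potential (x w) (xf w))%:E
   + (3 * theta)%:E * (n w)%:E) + (mu / 3)%:E * (eta ^+ 2 * batch_noise)%:E)).
  rewrite leeD2r//; apply: ge0_le_integral => //.
  - by move=> w _; rewrite lee_fin addr_ge0// mulr_ge0 ?sqr_ge0.
  - apply/measurable_EFinP; apply: measurable_funD => //.
    by apply: measurable_funM => //; exact: measurable_sqr_enorm.
  - apply: emeasurable_funD; apply: emeasurable_funM => //; exact/measurable_EFinP.
  - by move=> w _; rewrite -!EFinM -EFinD lee_fin.
have t10 : (0 <= 1 - tau)%R by lra.
have th30 : (0 <= 3 * theta)%R by rewrite mulr_ge0// ltW.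
rewrite ge0_integralD//; last 4 first.
- by move=> w _; rewrite -EFinM lee_fin mulr_ge0.
- by apply: emeasurable_funM => //; exact/measurable_EFinP.
- by move=> w _; rewrite -EFinM lee_fin mulr_ge0 ?sqr_ge0.
- by apply: emeasurable_funM => //; exact/measurable_EFinP.
rewrite ge0_integralZl ?lee_fin//; last 2 first.
- exact/measurable_EFinP.
- by move=> w _; rewrite lee_fin.
rewrite ge0_integralZl ?lee_fin//; last 2 first.
- exact/measurable_EFinP.
- by move=> w _; rewrite lee_fin sqr_ge0.
rewrite -addeA leeD2l//.
apply: (@le_trans _ _ ((3 * theta)%:E * batch_noise%:E +
    (mu / 3)%:E * (eta ^+ 2 * batch_noise)%:E)).
  by rewrite leeD2r//; apply: lee_wpmul2l => //; rewrite lee_fin.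
(* [30 = 27 + 3], from [3 theta = 27 tau^2 / mu] and [(mu / 3) eta^2 = 3 tau^2 / mu]. *)
rewrite -!EFinM -EFinD lee_fin le_eqVlt; apply/orP; left; apply/eqP.
by rewrite [in LHS]thE etaE; field; rewrite gt_eqF.
Qed.

End Step.

(** * Step sizes and complexity *)

Section Recursion.
Context {R : realType}.
Variables (K t0 eps a0 : R) (N1 : nat).
Hypotheses (K0 : 0 <= K) (t00 : 0 < t0) (t02 : t0 <= 2^-1).

(* In the second phase the error after j steps is at most (4 K + eps q) / (j + q)
   with q = 2 / t0; the value of q makes the step sizes start at t0. *)
Definition step_size (k : nat) : R :=
  if (k < N1)%N then t0 else 2 / ((k - N1)%:R + 2 / t0).

Fixpoint error_bound (k : nat) : R :=
  if k is k'.+1 then (1 - step_size k') * error_bound k' + K * step_size k' ^+ 2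
  else a0.

Let q : R := 2 / t0.

Lemma step_size_gt0 k : 0 < step_size k.
Proof.
rewrite /step_size; case: ifP => // _.
by rewrite divr_gt0// ltr_wpDl// divr_gt0.
Qed.

Lemma step_size_le k : step_size k <= t0.
Proof.
rewrite /step_size; case: ifP => // _.
have q0 : 0 < 2 / t0 by rewrite divr_gt0.
rewrite ler_pdivrMr ?ltr_wpDl// mulrDr [t0 * (2 / t0)]mulrC mulfVK ?gt_eqF//.
by rewrite lerDr mulr_ge0// ltW.
Qed.

(** [K * t0] is the fixed point of the recursion with constant step [t0]. *)
Lemma error_bound_geometric k : (k <= N1)%N ->
  error_bound k <= (1 - t0) ^+ k * a0 + K * t0.
Proof.
elim: k => [_|k ih kN] /=; first by rewrite mul1r lerDl mulr_ge0// ltW.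
have t1 : 0 <= 1 - t0 by move: t02; lra.
have := ler_wpM2l t1 (ih (ltnW kN)); rewrite /step_size kN [_ ^+ k.+1]exprS.
by move: ((1 - t0) ^+ k) (error_bound k) => p b; lra.
Qed.

(** With [t = j + q] and [Q] the numerator, the step [2 / t] adds at most [Q / t^2]. The induction
    closes because [(1 - 2 / t) Q / t + Q / t^2 = Q (t - 1) / t^2] and [(t - 1) (t + 1) <= t^2]. *)
Lemma error_bound_harmonic j : 0 <= eps ->
  (1 - t0) ^+ N1 * a0 <= eps ->
  error_bound (N1 + j) <= (4 * K + eps * q) / (j%:R + q).
Proof.
move=> e0 h.
have q0 : 4 <= q by rewrite /q ler_pdivlMr//; move: t02; lra.
have qp : 0 < q by lra.
elim: j => [|j ih].
  rewrite addn0 add0r (le_trans (error_bound_geometric (leqnn _)))//.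
  have -> : (4 * K + eps * q) / q = 2 * (K * t0) + eps.
    by rewrite /q; field; rewrite gt_eqF.
  by have := mulr_ge0 K0 (ltW t00); lra.
rewrite addnS /= /step_size ltnNge leq_addr/= addKn -/q.
have j0 : 0 <= j%:R :> R by [].
set t := j%:R + q in ih *; have t4 : 4 <= t by rewrite /t; lra.
have tp : 0 < t by lra.
set Q := 4 * K + eps * q in ih *.
have QK : 4 * K <= Q by rewrite lerDl mulr_ge0// ltW.
have Q0 : 0 <= Q by rewrite (le_trans _ QK)// mulr_ge0.
have -> : j.+1%:R + q = t + 1 by rewrite -natr1 /t; ring.
have w0 : 0 <= 1 - 2 / t by rewrite subr_ge0 ler_pdivrMr//; lra.
apply: (@le_trans _ _ ((1 - 2 / t) * (Q / t) + Q / t ^+ 2)).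
  rewrite lerD ?ler_wpM2l//.
  have -> : K * (2 / t) ^+ 2 = 4 * K / t ^+ 2 by field; rewrite gt_eqF.
  by rewrite ler_wpM2r// invr_ge0 sqr_ge0.
have -> : (1 - 2 / t) * (Q / t) + Q / t ^+ 2 = Q * ((t - 1) / t ^+ 2).
  by field; rewrite gt_eqF.
rewrite ler_wpM2l// ler_pdivrMr ?exprn_gt0// mulrC ler_pdivlMr; last by lra.
by rewrite -subr_ge0; have -> : t ^+ 2 - (t - 1) * (t + 1) = 1 by ring.
Qed.

(** The summand [eps * q] of the numerator cancels against the offset [q] of the denominator, so the
    length of the second phase does not depend on [t0]. *)
Lemma error_bound_le N2 : 0 < eps -> 4 * K / eps <= N2%:R ->
  (1 - t0) ^+ N1 * a0 <= eps -> error_bound (N1 + N2) <= eps.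
Proof.
move=> e0 h1 h2; rewrite (le_trans (error_bound_harmonic N2 (ltW e0) h2))//.
have q0 : 0 < q by rewrite divr_gt0.
rewrite ler_pdivrMr ?ltr_wpDl// mulrDr lerD2r.
by move: h1; rewrite ler_pdivrMr// [eps * _]mulrC.
Qed.

End Recursion.

(** [(1 - t)^n <= exp (- t n) <= eps^2], and one factor [eps] pays for [a0 <= 1 / eps]; hence the 2
    before the logarithm. *)
Lemma geometric_le (R : realType) (t a0 eps : R) (n : nat) :
  0 < t -> t <= 1 -> 0 < eps -> eps * a0 <= 1 ->
  2 * ln eps^-1 / t <= n%:R -> (1 - t) ^+ n * a0 <= eps.
Proof.
move=> t0 t1 e0 ea nl.
have p0 : 0 <= (1 - t) ^+ n by rewrite exprn_ge0//; lra.
have a1 : a0 <= eps^-1 by rewrite -(ler_pM2l e0) mulfV ?gt_eqF.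
have p1 : (1 - t) ^+ n <= eps ^+ 2.
  apply: (@le_trans _ _ (expR (- t) ^+ n)).
    rewrite lerXn2r ?nnegrE ?expR_ge0//; first by lra.
    exact: expR_ge1Dx.
  rewrite -expRM_natr -(lnK (x := eps ^+ 2)) ?posrE ?exprn_gt0//.
  rewrite ler_expR lnXn// -mulr_natr.
  move: nl; rewrite lnV ?posrE// ler_pdivrMr//; lra.
have := ler_pM p0 _ p1 (lexx eps^-1); rewrite invr_ge0 (ltW e0) => /(_ isT) h.
rewrite (le_trans (ler_wpM2l p0 a1))// (le_trans h)//.
by rewrite expr2 mulfK ?gt_eqF.
Qed.

(** Keeps the logarithm away from 0, so that it can absorb the rounding of the phase lengths. *)
Lemma ln_inv_ge_half (R : realType) (eps : R) :
  0 < eps -> eps <= 2^-1 -> 2^-1 <= ln eps^-1.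
Proof.
move=> e0 e2; rewrite lnV ?posrE// -(opprK 2^-1) lerN2.
rewrite -ler_expR lnK ?posrE//; apply: le_trans e2 _.
by apply: le_trans (expR_ge1Dx _); lra.
Qed.

Lemma tau_max_inv (R : realType) (mu delta : R) : 0 < mu -> mu < delta ->
  (tau_of mu (3 * delta)^-1)^-1 <= 6 * Num.sqrt (delta / mu).
Proof.
move=> mu0 mud; have d0 : 0 < delta by exact: lt_trans mud.
have t0 : 0 < tau_of mu (3 * delta)^-1.
  by apply: tau_of_gt0 => //; rewrite invr_gt0 mulr_gt0.
rewrite -[leLHS]mul1r ler_pdivrMr// /tau_of.
have -> : 6 * Num.sqrt (delta / mu) * (Num.sqrt (mu * (3 * delta)^-1) / 3) =
    2 * (Num.sqrt (delta / mu) * Num.sqrt (mu * (3 * delta)^-1)) by field.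
rewrite -sqrtrM; last by rewrite divr_ge0 ?ltW.
have -> : delta / mu * (mu * (3 * delta)^-1) = 3^-1 by field; rewrite !gt_eqF.
have : 2^-1 <= Num.sqrt (3^-1 : R).
  have -> : 2^-1 = Num.sqrt (4^-1 : R).
    by rewrite (_ : 4^-1 = 2^-1 ^+ 2) ?sqrtr_sqr ?ger0_norm//; field.
  by rewrite ler_sqrt//; lra.
lra.
Qed.

Theorem corollary1 (R : realType) :
  exists2 C : R, 0 < C &
  forall (d M B : nat) (hM : (0 < M)%N) (r : 'I_M -> 'rV[R]_d -> R)
    (xstar x0 : 'rV[R]_d) (mu L1 delta sigma_sim sigma_noise : R)
    (dX : measure_display) (Xi : measurableType dX)
    (nu : 'I_M -> probability Xi R) (G : 'I_M -> 'rV[R]_d -> Xi -> 'rV[R]_d),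
  (0 < B)%N -> (B < M)%N ->
  (forall m, twice_differentiable (r m)) ->
  is_minimizer (average r) xstar ->
  assumption1 hM r mu L1 ->
  assumption2 r xstar delta sigma_sim 0 ->
  assumption3 r nu G sigma_noise ->
  mu < delta ->
  let theta_max := (3 * delta)^-1 in
  let Phi0 := Phi r xstar (tau_of mu theta_max) (eta_of mu theta_max) x0 x0 in
  forall eps : R, 0 < eps -> eps <= 2^-1 -> eps * Phi0 <= 1 ->
  exists (theta : nat -> R) (N : nat),
  [/\ forall k, 0 < theta k <= theta_max,
      (1 <= N)%N,
      communications R M B N <=
        C * (B%:R / M%:R * Num.sqrt (delta / mu) * ln eps^-1
             + (sigma_sim ^+ 2 + sigma_noise ^+ 2) / (mu * M%:R * eps)) &
      forall (dO : measure_display) (Omega : measurableType dO)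
        (P : probability Omega R) (x xf : nat -> Omega -> 'rV[R]_d),
      let tau k := tau_of mu (theta k) in
      let eta k := eta_of mu (theta k) in
      ASEG hM r nu G B x0 delta (alpha_of mu) tau eta theta N P x xf ->
      ('E_P[fun w => Phi r xstar (tau N) (eta N) (x N w) (xf N w)] <= eps%:E)%E].
Proof.
(* [240 = 4 * 60] is dictated by the variance term: [4 K / eps] iterations with [K <= 60
   (sigma_sim^2 + sigma_noise^2) / (mu B)]. The logarithmic term needs only 16. *)
exists 240 => // d M B hM r xstar x0 mu L1 delta sigma_sim sigma_noise dX Xi nu G.
move=> B0 BM dr min A1 A2 A3 mud theta_max Phi0 eps e0 e2 ePhi.
have [mu0 _ _ _] := A1; have d0 : 0 < delta by exact: lt_trans mud.
have tm0 : 0 < theta_max by rewrite invr_gt0 mulr_gt0.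
pose t0 := tau_of mu theta_max; have t00 : 0 < t0 by exact: tau_of_gt0.
have t02 : t0 <= 2^-1 by exact: tau_of_le_half mu0 mud tm0 (lexx _).
pose L := ln eps^-1; have L0 : 2^-1 <= L by exact: ln_inv_ge_half.
pose V := batch_noise (B := B) sigma_sim sigma_noise; pose K := 30 / mu * V.
have B0' : 0 < B%:R :> R by rewrite ltr0n.
have M0 : 0 < M%:R :> R by rewrite ltr0n.
have V0 : 0 <= V by rewrite divr_ge0 ?addr_ge0 ?sqr_ge0// mulr_ge0 ?sqr_ge0.
have K0 : 0 <= K by rewrite mulr_ge0// divr_ge0// ltW.
have L00 : 0 <= L by apply: le_trans L0.
have n1 : 0 <= 2 * L / t0 by rewrite divr_ge0 ?(ltW t00)// mulr_ge0.
have n2 : 0 <= 4 * K / eps by rewrite divr_ge0 ?(ltW e0)// mulr_ge0.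
pose N1 := (Num.truncn (2 * L / t0)).+1; pose N2 := (Num.truncn (4 * K / eps)).+1.
have /andP[N1l N1u] := truncn_itv n1; have /andP[N2l N2u] := truncn_itv n2.
have Phi0E : Phi0 = potential r xstar mu x0 x0.
  by rewrite /Phi0 /Phi (tau_div_eta mu0 mud tm0 (lexx _)).
(* The schedule is designed for [tau]; this [theta] is the one for which [tau_of] returns [tk]. *)
pose tk := step_size t0 N1; pose theta k := 9 * tk k ^+ 2 / mu.
have tk0 k : 0 < tk k by exact: step_size_gt0.
have tau_theta k : tau_of mu (theta k) = tk k.
  rewrite /tau_of /theta (_ : mu * _ = (3 * tk k) ^+ 2); last by field; rewrite gt_eqF.
  by rewrite sqrtr_sqr ger0_norm ?mulr_ge0 ?ltW// mulrC mulKf.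
have th0 k : 0 < theta k by rewrite divr_gt0// mulr_gt0// exprn_gt0.
have thm k : theta k <= theta_max.
  rewrite (theta_tau mu0 tm0) -/t0 /theta ler_wpM2r ?invr_ge0 ?(ltW mu0)//.
  rewrite ler_wpM2l// lerXn2r ?nnegrE ?(ltW (tk0 _)) ?(ltW t00)//.
  exact: step_size_le.
exists theta, (N1 + N2)%N; split => //.
- by move=> k; rewrite th0 thm.
- pose s := Num.sqrt (delta / mu).
  have s1 : 1 <= s.
    have dm : 1 <= delta / mu by rewrite ler_pdivlMr// mul1r ltW.
    by rewrite -[leLHS]sqrtr1; exact: ler_wsqrtr.
  have inv_t0 : t0^-1 <= 6 * s by exact: tau_max_inv.
  have sL : 2^-1 <= L * s by nra.
  have N1b : N1%:R <= 1 + 12 * (L * s).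
    rewrite /N1 -natr1; have : 2 * L / t0 <= 12 * (L * s).
      have L2 : 0 <= 2 * L by rewrite mulr_ge0.
      by have := ler_wpM2l L2 inv_t0; lra.
    by move: N1l; lra.
  have N2b : N2%:R <= 1 + 4 * K / eps by rewrite /N2 -natr1; move: N2l; lra.
  have Kb : K <= 60 * (sigma_sim ^+ 2 + sigma_noise ^+ 2) / (mu * B%:R).
    rewrite /K /V /batch_noise.
    have -> : 30 / mu * ((2 * sigma_sim ^+ 2 + sigma_noise ^+ 2) / B%:R) =
      30 * (2 * sigma_sim ^+ 2 + sigma_noise ^+ 2) / (mu * B%:R).
      by field; rewrite !gt_eqF.
    rewrite ler_wpM2r ?invr_ge0 ?(ltW (mulr_gt0 mu0 B0'))//.
    by have := sqr_ge0 sigma_noise; lra.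
  rewrite /communications natrD -/s -/L.
  (* The two roundings cost 2, at most [4 L s] because [L s >= 1 / 2]. *)
  have Nb : N1%:R + N2%:R <= 16 * (L * s) + 4 * K / eps by lra.
  have BM0 : 0 <= B%:R / M%:R :> R by rewrite divr_ge0.
  apply: le_trans (ler_wpM2r BM0 Nb) _.
  have K4 : 4 * K / eps * (B%:R / M%:R) <=
      240 * ((sigma_sim ^+ 2 + sigma_noise ^+ 2) / (mu * M%:R * eps)).
    have -> : 240 * ((sigma_sim ^+ 2 + sigma_noise ^+ 2) / (mu * M%:R * eps)) =
      60 * (sigma_sim ^+ 2 + sigma_noise ^+ 2) / (mu * B%:R) *
        (4 / eps * (B%:R / M%:R)) by field; rewrite !gt_eqF.
    have -> : 4 * K / eps * (B%:R / M%:R) = K * (4 / eps * (B%:R / M%:R)).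
      by field; rewrite !gt_eqF.
    by rewrite ler_wpM2r// mulr_ge0// divr_ge0// ltW.
  have p0 : 0 <= B%:R / M%:R * (L * s) by rewrite mulr_ge0//; lra.
  lra.
move=> dO Omega P x xf tau eta.
move=> [init [F [H [I [J [xi [xi' [sFH FH mxk freshk step]]]]]]]].
(* The final [Phi] uses parameters indexed one past the last iteration; their ratio is [mu / 3] all
   the same. *)
have PhiE w : Phi r xstar (tau (N1 + N2)%N) (eta (N1 + N2)%N) (x (N1 + N2)%N w)
    (xf (N1 + N2)%N w) = potential r xstar mu (x (N1 + N2)%N w) (xf (N1 + N2)%N w).
  by rewrite /Phi /tau /eta (tau_div_eta mu0 mud (th0 _) (thm _)).
have main k : (k <= N1 + N2)%N ->
    (\int[P]_w (potential r xstar mu (x k w) (xf k w))%:E <=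
    (error_bound K t0 Phi0 N1 k)%:E)%E.
  elim: k => [_|k ih kN].
    under eq_integral do rewrite (init _).1 (init _).2.
    by rewrite integral_probability_cst -Phi0E.
  have [my frI frJ] := freshk k kN.
  have [mx mxf] := mxk k (ltnW kN); have [mx' _] := mxk k.+1 kN.
  have mxc : measurable_coords (x k.+1).
    by move=> i _ U mU; rewrite setTI; apply: (sFH k.+1).1.2; exact: mx'.
  have := @expected_step _ _ _ _ hM r xstar mu L1 delta sigma_sim sigma_noise _ _
    nu G B0 BM dr min A1 A2 A3 mud _ _ P (theta k) (F k) (H k) (x k) (xf k)
    (xf k.+1) (x k.+1) (I k) (J k) (xi k) (xi' k) (th0 k) (thm k) (sFH k).1 (sFH k).2
    (FH k).1 mx mxf my mxc frI frJ.
  move=> /(_ (fun w => (step k w kN).1) (fun w => (step k w kN).2)) /le_trans; apply.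
  have tk1 : 0 <= 1 - tk k by have := step_size_le N1 t00 k; rewrite -/(tk k); lra.
  rewrite tau_theta /= -/(tk k) [leRHS]EFinD; apply: leeD.
    rewrite [leRHS]EFinM; apply: lee_wpmul2l; first by rewrite lee_fin.
    exact: ih (ltnW kN).
  rewrite lee_fin le_eqVlt; apply/orP; left; apply/eqP.
  by rewrite /K /V; field; rewrite gt_eqF.
rewrite unlock; under eq_integral do rewrite PhiE.
apply: le_trans (main _ (leqnn _)) _; rewrite lee_fin.
apply: error_bound_le => //; first by rewrite ltW.
by apply: geometric_le => //; [lra|rewrite ltW].
Qed.
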